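(* Let $X$ be a complex Banach space, $\alpha>0$, and $T\in\mathcal{B}(X)$ a $(C,\alpha)$-bounded operator with $\sigma(T)\cap\mathbb{T}\subseteq\{1\}$. Then $$\lim_{n\to\infty}\|M_T^\alpha(n+1)-M_T^\alpha(n)\|=0.$$
   Context: $\mathbb{T}$ is the unit circle in $\mathbb{C}$, $\sigma(T)$ the spectrum. For $\alpha>0$, $k^\alpha(n)=\frac{\Gamma(n+\alpha)}{\Gamma(\alpha)\Gamma(n+1)}$, $n\in\mathbb{N}_0$. $\Delta^{-\alpha}\mathcal{T}(n)=\sum_{j=0}^nk^\alpha(n-j)T^j$, $M_T^\alpha(n)=\Delta^{-\alpha}\mathcal{T}(n)/k^{\alpha+1}(n)$; $T$ is $(C,\alpha)$-bounded if $\sup_n\|M_T^\alpha(n)\|<\infty$. *)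

(* Defs.v *)
From Stdlib Require Import Reals Lra ClassicalEpsilon.
Open Scope R_scope.

Record Cpx := mkC { Cre : R; Cim : R }.
Definition Cx0 : Cpx := mkC 0 0.
Definition Cx1 : Cpx := mkC 1 0.
Definition RtoC (r : R) : Cpx := mkC r 0.
Definition Cadd (a b : Cpx) : Cpx := mkC (Cre a + Cre b) (Cim a + Cim b).
Definition Cmul (a b : Cpx) : Cpx :=
  mkC (Cre a * Cre b - Cim a * Cim b) (Cre a * Cim b + Cim a * Cre b).
Definition Cmod (a : Cpx) : R := sqrt (Cre a ^ 2 + Cim a ^ 2).

Record CBanach := {
  carrier :> Type;
  vzero : carrier;
  vadd : carrier -> carrier -> carrier;
  vopp : carrier -> carrier;
  vscal : Cpx -> carrier -> carrier;
  vnorm : carrier -> R;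
  vadd_assoc : forall x y z, vadd x (vadd y z) = vadd (vadd x y) z;
  vadd_comm : forall x y, vadd x y = vadd y x;
  vadd_0 : forall x, vadd x vzero = x;
  vadd_opp : forall x, vadd x (vopp x) = vzero;
  vscal_1 : forall x, vscal Cx1 x = x;
  vscal_assoc : forall a b x, vscal a (vscal b x) = vscal (Cmul a b) x;
  vscal_distr_v : forall a x y, vscal a (vadd x y) = vadd (vscal a x) (vscal a y);
  vscal_distr_s : forall a b x, vscal (Cadd a b) x = vadd (vscal a x) (vscal b x);
  vnorm_eq0 : forall x, vnorm x = 0 -> x = vzero;
  vnorm_scal : forall a x, vnorm (vscal a x) = Cmod a * vnorm x;
  vnorm_triangle : forall x y, vnorm (vadd x y) <= vnorm x + vnorm y;
  vcomplete : forall u : nat -> carrier,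
    (forall eps, 0 < eps -> exists N, forall m n, (N <= m)%nat -> (N <= n)%nat ->
        vnorm (vadd (u m) (vopp (u n))) < eps) ->
    exists l, forall eps, 0 < eps -> exists N, forall n, (N <= n)%nat ->
        vnorm (vadd (u n) (vopp l)) < eps
}.

Arguments vzero {_}. Arguments vadd {_}. Arguments vopp {_}.
Arguments vscal {_}. Arguments vnorm {_}.

Section Ops.
Context {X : CBanach}.

Definition vsub (x y : X) : X := vadd x (vopp y).

Definition bounded_linear (T : X -> X) : Prop :=
  (forall x y, T (vadd x y) = vadd (T x) (T y)) /\
  (forall a x, T (vscal a x) = vscal a (T x)) /\
  (exists M, forall x, vnorm (T x) <= M * vnorm x).

Definition unit_ball_image (A : X -> X) (r : R) : Prop :=
  exists x : X, vnorm x <= 1 /\ r = vnorm (A x).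
Definition opnorm (A : X -> X) : R :=
  epsilon (inhabits 0) (fun r => is_lub (unit_ball_image A) r).

Definition in_spectrum (T : X -> X) (l : Cpx) : Prop :=
  ~ exists S : X -> X, bounded_linear S /\
      (forall x, S (vsub (vscal l x) (T x)) = x) /\
      (forall x, vsub (vscal l (S x)) (T (S x)) = x).

Fixpoint vsum (n : nat) (f : nat -> X) : X :=
  match n with
  | O => f O
  | S m => vadd (vsum m f) (f (S m))
  end.

End Ops.

(* Cesaro numbers k^alpha(n) = Gamma(n+alpha)/(Gamma(alpha) Gamma(n+1)),
   written via Gamma(x+1) = x Gamma(x) as prod_{j=1}^n (alpha+j-1)/j. *)
Fixpoint kC (alpha : R) (n : nat) : R :=
  match n with
  | O => 1
  | S m => kC alpha m * (alpha + INR m) / INR (S m)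
  end.

Definition DeltaT {X : CBanach} (alpha : R) (T : X -> X) (n : nat) (x : X) : X :=
  vsum n (fun j => vscal (RtoC (kC alpha (n - j))) (Nat.iter j T x)).

Definition MT {X : CBanach} (alpha : R) (T : X -> X) (n : nat) (x : X) : X :=
  vscal (RtoC (/ kC (alpha + 1) n)) (DeltaT alpha T n x).

Definition Cesaro_bounded {X : CBanach} (alpha : R) (T : X -> X) : Prop :=
  exists K, forall n, opnorm (MT alpha T n) <= K.

(* Main.v *)
From Stdlib Require Import Reals Lra Lia Classical ClassicalEpsilon.
From Corelib Require Import ssreflect.
From Coquelicot Require Import Coquelicot.
Require Import Defs.
Open Scope R_scope.

(* A discrete Katznelson-Tzafriri argument. Write s(n) for the Cesaro sum
   Delta^{-alpha} T (n) applied to a vector x of the unit ball, k for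
   k^{alpha+1}, and P(z) = sum_{n < 2m} s(n) z^n. As k(n+1)/k(n) -> 1, it is
   enough to show that s(m) - s(m-1) = o(k(m)), uniformly in x. By Fourier
   inversion on the (2m)-th roots of unity, s(m) - s(m-1) is the mean of
   z^m (1 - z) P(z), where z^m = +-1 alternates from one root to the next.
   The recurrence s(n+1) = T s(n) + k^alpha(n+1) x gives there
     (1 - z T) P(z) = kappa(z) x - T s(2m-1),
     kappa(z) = sum_{n < 2m} k^alpha(n) z^n.
   Let V be a trapezoidal cutoff of width delta around z = 1.
   - (1 - z) V(z) has Fourier coefficients of l1 norm O(delta), and
     s(n) = O(k(m)) for n < 2m, so this part contributes O(delta) k(m).
   - On the support of 1 - V, which stays away from 1, (1 - z T)^{-1} is
     bounded and Lipschitz uniformly in m, by compactness;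
     (1 - z) kappa(z) is O(1 + k^alpha(2m-1)) = o(k(m)) by partial summation,
     and the term with T s(2m-1) is averaged out by the alternating sign. *)

(** * The Banach space as a module over the complex numbers, and its norm *)

Definition to_Cpx (c : C) : Cpx := mkC (fst c) (snd c).

Definition CBanach_AbelianMonoid_mixin (X : CBanach) :=
  AbelianMonoid.Mixin X vadd vzero (vadd_comm X) (vadd_assoc X) (vadd_0 X).
Canonical CBanach_AbelianMonoid (X : CBanach) :=
  AbelianMonoid.Pack X (CBanach_AbelianMonoid_mixin X) X.
Definition CBanach_AbelianGroup_mixin (X : CBanach) :=
  AbelianGroup.Mixin (CBanach_AbelianMonoid X) vopp (vadd_opp X).
Canonical CBanach_AbelianGroup (X : CBanach) :=
  AbelianGroup.Pack X
    (AbelianGroup.Class X (CBanach_AbelianMonoid_mixin X)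
       (CBanach_AbelianGroup_mixin X)) X.
(** Sums and products of pairs reduce under [to_Cpx] to [Cadd] and [Cmul], so the axioms of [vscal]
    transfer by conversion. *)
Definition CBanach_ModuleSpace_mixin (X : CBanach) :=
  ModuleSpace.Mixin C_Ring (CBanach_AbelianGroup X)
    (fun c x => vscal (to_Cpx c) x)
    (fun a b x => vscal_assoc X (to_Cpx a) (to_Cpx b) x)
    (vscal_1 X)
    (fun a x y => vscal_distr_v X (to_Cpx a) x y)
    (fun a b x => vscal_distr_s X (to_Cpx a) (to_Cpx b) x).
Canonical CBanach_ModuleSpace (X : CBanach) :=
  ModuleSpace.Pack C_Ring X
    (ModuleSpace.Class C_Ring X _ (CBanach_ModuleSpace_mixin X)) X.

Lemma vsum_sum_n (X : CBanach) (f : nat -> X) n : vsum n f = sum_n f n.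
Proof.
  induction n as [|n IH]; simpl.
  - now rewrite sum_O.
  - rewrite sum_Sn IH. reflexivity.
Qed.

Lemma vnorm_scal_C (X : CBanach) (c : C) (x : X) :
  vnorm (scal c x) = Complex.Cmod c * vnorm x.
Proof. exact (vnorm_scal X (to_Cpx c) x). Qed.

Lemma vnorm_plus (X : CBanach) (x y : X) : vnorm (plus x y) <= vnorm x + vnorm y.
Proof. exact (vnorm_triangle X x y). Qed.

Lemma vnorm_zero (X : CBanach) : vnorm (zero : X) = 0.
Proof.
  rewrite -(scal_zero_l (zero : X)) vnorm_scal_C Cmod_0. ring.
Qed.

Lemma vnorm_opp (X : CBanach) (x : X) : vnorm (opp x) = vnorm x.
Proof.
  rewrite -(scal_opp_one x) vnorm_scal_C Cmod_opp Cmod_1. ring.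
Qed.

Lemma vnorm_ge_0 (X : CBanach) (x : X) : 0 <= vnorm x.
Proof.
  pose proof (vnorm_plus X x (opp x)) as H.
  rewrite plus_opp_r vnorm_zero vnorm_opp in H. lra.
Qed.

Lemma vnorm_minus (X : CBanach) (x y : X) : vnorm (minus x y) <= vnorm x + vnorm y.
Proof.
  unfold minus. rewrite -(vnorm_opp X y). apply vnorm_plus.
Qed.

Ltac Cring :=
  match goal with |- @eq _ ?a ?b => change (@eq C a b) end;
  change (@plus _) with Cplus; change (@mult _) with Cmult;
  change (@opp _) with Copp; change (@minus _) with Cminus;
  ring.

(** * Finite sums *)

Lemma sum_n_R_S (a : nat -> R) n : sum_n a (S n) = sum_n a n + a (S n).
Proof. exact (sum_Sn a n). Qed.

Lemma sum_n_R_le (a b : nat -> R) n :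
  (forall i, (i <= n)%nat -> a i <= b i) -> sum_n a n <= sum_n b n.
Proof.
  induction n as [|n IH]; intros H.
  - rewrite !sum_O. apply H; lia.
  - rewrite !sum_n_R_S. assert (IH' := IH ltac:(intros; apply H; lia)).
    specialize (H (S n) (le_n _)). lra.
Qed.

Lemma vnorm_sum_n (X : CBanach) (f : nat -> X) n :
  vnorm (sum_n f n) <= sum_n (fun i => vnorm (f i)) n.
Proof.
  induction n as [|n IH].
  - rewrite !sum_O. lra.
  - rewrite sum_n_R_S sum_Sn.
    eapply Rle_trans; [apply vnorm_plus|]. lra.
Qed.

Lemma scal_sum_n_l (K : Ring) (V : ModuleSpace K) (c : nat -> K) (x : V) n :
  sum_n (fun i => scal (c i) x) n = scal (sum_n c n) x.
Proof.
  induction n as [|n IH].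
  - now rewrite !sum_O.
  - now rewrite !sum_Sn IH scal_distr_r.
Qed.

(** The support of [f] lies between [b] and [N], so translation by [b] keeps it inside the range of
    summation. It moves translates of [window] back into place. *)
Lemma sum_n_shift (G : AbelianGroup) (f : nat -> G) N b :
  (forall i, (i < b)%nat -> f i = zero) ->
  (forall i, (N < i)%nat -> f i = zero) ->
  sum_n (fun i => f (i + b)%nat) N = sum_n f N.
Proof.
  intros Hl Hr. induction b as [|b IH].
  - apply sum_n_ext; intros; f_equal; lia.
  - rewrite -IH; [|intros; apply Hl; lia]. clear IH.
    set (g := fun i => f (i + b)%nat).
    transitivity (sum_n (fun i => g (S i)) N).
    { apply sum_n_ext; intros; unfold g; f_equal; lia. }
    assert (H0 : g 0%nat = zero) by (apply Hl; simpl; lia).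
    assert (HN : g (S N) = zero) by (apply Hr; lia).
    transitivity (sum_n g (S N)).
    + unfold sum_n. rewrite sum_n_m_S.
      rewrite (sum_Sn_m g 0 (S N)); [|lia]. now rewrite H0 plus_zero_l.
    + now rewrite sum_Sn HN plus_zero_r.
Qed.

Lemma sum_n_kronecker (K : Ring) (V : ModuleSpace K) (c : K) (f : nat -> V) m N :
  (m <= N)%nat ->
  sum_n (fun n => scal (if Nat.eqb n m then c else zero) (f n)) N = scal c (f m).
Proof.
  intros Hm.
  assert (Hz : forall n, (n < m)%nat ->
    sum_n (fun n => scal (if Nat.eqb n m then c else zero) (f n)) n = zero).
  { induction n as [|n IH]; intros Hn.
    - rewrite sum_O. destruct (Nat.eqb_spec 0 m); [lia|]. apply scal_zero_l.
    - rewrite sum_Sn IH; [|lia]. destruct (Nat.eqb_spec (S n) m); [lia|].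
      now rewrite scal_zero_l plus_zero_l. }
  induction Hm as [|N Hm IH].
  - destruct m as [|m].
    + now rewrite sum_O.
    + rewrite sum_Sn Hz; [|lia]. now rewrite plus_zero_l Nat.eqb_refl.
  - rewrite sum_Sn IH. destruct (Nat.eqb_spec (S N) m); [lia|].
    now rewrite scal_zero_l plus_zero_r.
Qed.

(** * Points of the unit circle: chords and geometric sums *)

Definition cis (t : R) : C := (cos t, sin t).

Lemma cis_plus a b : cis (a + b) = Cmult (cis a) (cis b).
Proof.
  unfold cis, Cmult; simpl. rewrite cos_plus sin_plus. f_equal; ring.
Qed.

Lemma cis_0 : cis 0 = Complex.RtoC 1.
Proof. unfold cis. rewrite cos_0 sin_0. reflexivity. Qed.

Lemma Cmod_cis t : Complex.Cmod (cis t) = 1.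
Proof.
  unfold Complex.Cmod, cis; simpl.
  replace (_ + _) with 1; [apply sqrt_1|].
  pose proof (sin2_cos2 t) as H. unfold Rsqr in H. lra.
Qed.

Lemma Cconj_cis t : Cconj (cis t) = cis (- t).
Proof. unfold Cconj, cis; simpl. now rewrite cos_neg sin_neg. Qed.

Lemma sin_sqr_le x : sin x ^ 2 <= x ^ 2.
Proof.
  assert (H : forall y, 0 <= y -> sin y ^ 2 <= y ^ 2).
  { intros y Hy. destruct (Rle_lt_dec y 1) as [H1|H1].
    - destruct (Req_dec y 0) as [->|H0]; [rewrite sin_0; lra|].
      assert (0 <= sin y) by (apply sin_ge_0; pose proof PI2_1; lra).
      assert (sin y < y) by (apply sin_lt_x; lra). nra.
    - pose proof (SIN_bound y). nra. }
  destruct (Rle_lt_dec 0 x) as [Hx|Hx]; [auto|].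
  specialize (H (- x) ltac:(lra)). rewrite sin_neg in H. nra.
Qed.

(** The chord length 2 |sin((a - b)/2)|, squared to avoid the square root and the absolute value. *)
Lemma Cmod_cis_minus_sqr a b :
  Complex.Cmod (Cminus (cis a) (cis b)) ^ 2 = 4 * sin ((a - b) / 2) ^ 2.
Proof.
  rewrite Cmod2_alt. unfold cis, Cminus, Cplus, Copp, Re, Im; simpl fst; simpl snd.
  replace (4 * sin ((a - b) / 2) ^ 2) with (2 * (1 - cos (2 * ((a - b) / 2)))).
  2:{ rewrite cos_2a_sin. ring. }
  replace (2 * ((a - b) / 2)) with (a - b) by field.
  rewrite cos_minus.
  pose proof (sin2_cos2 a). pose proof (sin2_cos2 b). unfold Rsqr in *. nra.
Qed.

Lemma Cmod_cis_minus a b : Complex.Cmod (Cminus (cis a) (cis b)) <= Rabs (a - b).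
Proof.
  apply Rsqr_incr_0_var; [|apply Rabs_pos].
  rewrite -Rsqr_abs !Rsqr_pow2 Cmod_cis_minus_sqr.
  pose proof (sin_sqr_le ((a - b) / 2)). lra.
Qed.

Lemma cis_neq_1 t : t <> 0 -> Rabs t < 2 * PI -> cis t <> Complex.RtoC 1.
Proof.
  intros H0 Ht He.
  assert (H : sin ((t - 0) / 2) ^ 2 = 0).
  { pose proof (Cmod_cis_minus_sqr t 0) as H. rewrite He cis_0 in H.
    replace (Cminus _ _) with (Complex.RtoC 0) in H by ring.
    rewrite Cmod_0 in H. lra. }
  replace ((t - 0) / 2) with (t / 2) in H by field.
  assert (Hs : sin (t / 2) = 0) by nra.
  destruct (Rlt_le_dec 0 t) as [Hp|Hp].
  - rewrite Rabs_right in Ht; [|lra].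
    pose proof (sin_gt_0 (t / 2) ltac:(lra) ltac:(lra)). lra.
  - rewrite Rabs_left1 in Ht; [|lra].
    pose proof (sin_gt_0 (- (t / 2)) ltac:(lra) ltac:(lra)) as H1.
    rewrite sin_neg in H1. lra.
Qed.

Lemma cis_2PI_INR n : cis (2 * PI * INR n) = Complex.RtoC 1.
Proof.
  replace (2 * PI * INR n) with (0 + 2 * INR n * PI) by ring.
  unfold cis. rewrite cos_period sin_period cos_0 sin_0. reflexivity.
Qed.

Lemma cis_2PI_INR_minus n k : cis (2 * PI * (INR n - INR k)) = Complex.RtoC 1.
Proof.
  replace (2 * PI * (INR n - INR k)) with (2 * PI * INR n + - (2 * PI * INR k)) by ring.
  rewrite cis_plus -Cconj_cis !cis_2PI_INR.
  unfold Cconj, Cmult, Complex.RtoC; simpl. f_equal; ring.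
Qed.

(** A geometric sum: multiplied by [cis t - 1] it telescopes to [cis ((N + 1) t) - 1], which is
    zero. *)
Lemma sum_cis_eq_0 t N :
  cis t <> Complex.RtoC 1 -> cis (INR (S N) * t) = Complex.RtoC 1 ->
  sum_n (fun n => cis (INR n * t)) N = (Complex.RtoC 0).
Proof.
  intros H1 HN.
  assert (Hg : forall n, Cmult (Cminus (cis t) (Complex.RtoC 1)) (sum_n (fun n => cis (INR n * t)) n)
    = Cminus (cis (INR (S n) * t)) (Complex.RtoC 1)).
  { induction n as [|n IH].
    - rewrite sum_O. simpl INR. rewrite Rmult_0_l Rmult_1_l cis_0. ring.
    - rewrite sum_Sn.
      change (plus ?a ?b) with (Cplus a b).
      rewrite Cmult_plus_distr_l IH.
      replace (INR (S (S n)) * t) with (t + INR (S n) * t) by (rewrite (S_INR (S n)); ring).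
      rewrite cis_plus. ring. }
  specialize (Hg N). rewrite HN in Hg.
  assert (Hn : Cminus (cis t) (Complex.RtoC 1) <> Complex.RtoC 0).
  { intros H. apply H1. replace (cis t) with (Cplus (Cminus (cis t) (Complex.RtoC 1)) (Complex.RtoC 1)) by ring.
    rewrite H. ring. }
  replace (sum_n _ _) with (Cmult (Cinv (Cminus (cis t) (Complex.RtoC 1)))
    (Cmult (Cminus (cis t) (Complex.RtoC 1)) (sum_n (fun n => cis (INR n * t)) N))).
  - rewrite Hg. Cring.
  - match goal with |- @eq _ ?a ?b => change (@eq C a b) end. field. exact Hn.
Qed.

(** * Parseval's identity and products of exponential sums *)

Lemma sum_n_R_mult_l (c : R) (a : nat -> R) n :
  sum_n (fun i => c * a i) n = c * sum_n a n.
Proof. exact (sum_n_mult_l c a n). Qed.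

Lemma sum_n_C_mult_l (c : C) (a : nat -> C) n :
  sum_n (fun i => Cmult c (a i)) n = Cmult c (sum_n a n).
Proof. exact (sum_n_mult_l c a n). Qed.

Lemma sum_n_C_mult_r (c : C) (a : nat -> C) n :
  sum_n (fun i => Cmult (a i) c) n = Cmult (sum_n a n) c.
Proof. exact (sum_n_mult_r c a n). Qed.

Lemma sum_n_C_minus (a b : nat -> C) n :
  sum_n (fun i => Cminus (a i) (b i)) n = Cminus (sum_n a n) (sum_n b n).
Proof.
  induction n as [|n IH].
  - now rewrite !sum_O.
  - rewrite !sum_Sn IH. Cring.
Qed.

Lemma sum_n_RtoC (a : nat -> R) n :
  sum_n (fun i => Complex.RtoC (a i)) n = Complex.RtoC (sum_n a n).
Proof.
  induction n as [|n IH].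
  - now rewrite !sum_O.
  - rewrite !sum_Sn IH. symmetry. apply RtoC_plus.
Qed.

Lemma sum_n_Cconj (a : nat -> C) n :
  sum_n (fun i => Cconj (a i)) n = Cconj (sum_n a n).
Proof.
  induction n as [|n IH].
  - now rewrite !sum_O.
  - rewrite !sum_Sn IH. unfold Cconj. apply injective_projections; simpl; [easy|].
    unfold plus; simpl. ring.
Qed.

Lemma sum_n_C_const (c : C) n :
  sum_n (fun _ => c) n = Cmult (Complex.RtoC (INR (S n))) c.
Proof.
  induction n as [|n IH].
  - rewrite sum_O. simpl INR. Cring.
  - rewrite sum_Sn IH (S_INR (S n)) RtoC_plus. Cring.
Qed.

(** Up to normalization, the [l]-th Fourier coefficient of the measure with mass [u i] at the angle
    [t i]: the sum runs over the nodes, and [l] is the frequency. *)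
Definition trig (t : nat -> R) (u : nat -> C) (J l : nat) : C :=
  sum_n (fun i => Cmult (u i) (cis (INR l * t i))) J.

Definition orthogonal_nodes (t : nat -> R) (J N : nat) : Prop :=
  forall i j, (i <= J)%nat -> (j <= J)%nat -> i <> j ->
  sum_n (fun n => cis (INR n * (t i - t j))) N = Complex.RtoC 0.

(** Expanding the squared modulus gives a double sum over nodes; after summation over [n],
    orthogonality leaves the diagonal, where each term is counted [N + 1] times. *)
Lemma parseval (t : nat -> R) (u : nat -> C) J N :
  orthogonal_nodes t J N ->
  sum_n (fun n => Complex.Cmod (trig t u J n) ^ 2) N
  = INR (S N) * sum_n (fun i => Complex.Cmod (u i) ^ 2) J.
Proof.
  intros Ho. apply RtoC_inj. rewrite -sum_n_RtoC.
  transitivity (sum_n (fun n => sum_n (fun i => sum_n (fun j =>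
      Cmult (Cmult (u i) (Cconj (u j))) (cis (INR n * (t i - t j)))) J) J) N).
  { apply sum_n_ext; intros n. rewrite Cmod2_conj.
    unfold trig at 2. rewrite -sum_n_Cconj -sum_n_C_mult_l sum_n_switch.
    apply sum_n_ext; intros j. unfold trig. rewrite -sum_n_C_mult_r.
    apply sum_n_ext; intros i.
    replace (INR n * (t i - t j)) with (INR n * t i + - (INR n * t j)) by ring.
    rewrite cis_plus -Cconj_cis. rewrite Cmult_conj. Cring. }
  rewrite sum_n_switch RtoC_mult -sum_n_RtoC -sum_n_C_mult_l.
  apply sum_n_ext_loc; intros i Hi.
  rewrite sum_n_switch.
  transitivity (sum_n (fun j => scal (if Nat.eqb j i then Complex.RtoC (INR (S N)) else (zero : C_Ring))
      (Cmult (u i) (Cconj (u j)))) J).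
  - apply sum_n_ext_loc; intros j Hj. rewrite sum_n_C_mult_l.
    destruct (Nat.eqb_spec j i) as [->|Hne].
    + replace (t i - t i) with 0 by ring.
      transitivity (Cmult (Cmult (u i) (Cconj (u i))) (sum_n (fun _ => Complex.RtoC 1) N)).
      * f_equal. apply sum_n_ext; intros n. now rewrite Rmult_0_r cis_0.
      * rewrite sum_n_C_const. change (@scal _ _) with Cmult. Cring.
    + rewrite Ho; auto. change (@scal _ _) with Cmult.
      change (@zero _) with (Complex.RtoC 0). Cring.
  - rewrite (sum_n_kronecker C_Ring C_ModuleSpace); [|easy].
    rewrite Cmod2_conj. reflexivity.
Qed.

Lemma trig_shift t u J n m :
  trig t u J (n + m) = trig t (fun i => Cmult (u i) (cis (INR m * t i))) J n.
Proof.
  apply sum_n_ext; intros i. rewrite plus_INR Rmult_plus_distr_r cis_plus. Cring.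
Qed.

Lemma trig_diff t u J l :
  Cminus (trig t u J l) (trig t u J (S l))
  = trig t (fun i => Cmult (u i) (Cminus (cis 0) (cis (t i)))) J l.
Proof.
  unfold trig. rewrite -sum_n_C_minus. apply sum_n_ext; intros i.
  rewrite S_INR Rmult_plus_distr_r Rmult_1_l cis_plus cis_0. Cring.
Qed.

(** A shift of the frequency multiplies the masses by unimodular numbers, which leaves their square
    sum unchanged. *)
Lemma parseval_shift t u J N m :
  orthogonal_nodes t J N ->
  sum_n (fun n => Complex.Cmod (trig t u J (n + m)) ^ 2) N
  = INR (S N) * sum_n (fun i => Complex.Cmod (u i) ^ 2) J.
Proof.
  intros Ho.
  transitivity (sum_n (fun n => Complex.Cmod (trig t (fun i => Cmult (u i) (cis (INR m * t i))) J n) ^ 2) N).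
  { apply sum_n_ext; intros n. now rewrite trig_shift. }
  rewrite parseval; [|easy]. f_equal. apply sum_n_ext; intros i.
  now rewrite Cmod_mult Cmod_cis Rmult_1_r.
Qed.

(** One step in frequency multiplies [u i] by [1 - cis (t i)], of modulus at most |t i|. The
    hypothesis carries the factor [Cmod (u i)] so that nodes without mass may lie anywhere. *)
Lemma parseval_diff_le t u J N m eta :
  orthogonal_nodes t J N ->
  (forall i, (i <= J)%nat -> Complex.Cmod (u i) * Rabs (t i) <= eta * Complex.Cmod (u i)) ->
  sum_n (fun n => Complex.Cmod (Cminus (trig t u J (n + m)) (trig t u J (S (n + m)))) ^ 2) N
  <= INR (S N) * (eta ^ 2 * sum_n (fun i => Complex.Cmod (u i) ^ 2) J).
Proof.
  intros Ho Hu.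
  rewrite (sum_n_ext _ (fun n => Complex.Cmod (trig t
     (fun i => Cmult (u i) (Cminus (cis 0) (cis (t i)))) J (n + m)) ^ 2)).
  2:{ intros n. now rewrite trig_diff. }
  rewrite parseval_shift; [|easy]. apply Rmult_le_compat_l; [apply pos_INR|].
  rewrite -sum_n_R_mult_l. apply sum_n_R_le; intros i Hi.
  rewrite Cmod_mult.
  replace (eta ^ 2 * Complex.Cmod (u i) ^ 2) with ((eta * Complex.Cmod (u i)) ^ 2) by ring.
  apply pow_incr. split.
  - apply Rmult_le_pos; apply Cmod_ge_0.
  - eapply Rle_trans; [|apply Hu; easy].
    apply Rmult_le_compat_l; [apply Cmod_ge_0|].
    pose proof (Cmod_cis_minus 0 (t i)) as H.
    now rewrite Rminus_0_l Rabs_Ropp in H.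
Qed.

(** The difference of the two sides is a multiple of [(a - eta b)^2]. When the square sum of [a] is
    of order [eta^2] and that of [b] of order 1, both terms are of order [eta]. *)
Lemma weighted_am_gm eta a b : 0 < eta -> a * b <= / (2 * eta) * a ^ 2 + eta / 2 * b ^ 2.
Proof.
  intros He.
  assert (H : / (2 * eta) * a ^ 2 + eta / 2 * b ^ 2 - a * b = / (2 * eta) * (a - eta * b) ^ 2)
    by (field; lra).
  assert (0 <= / (2 * eta) * (a - eta * b) ^ 2).
  { apply Rmult_le_pos; [apply Rlt_le, Rinv_0_lt_compat; lra | apply pow2_ge_0]. }
  lra.
Qed.

(* The factor [eta] is gained because taking a difference in frequency
   multiplies by [1 - cis t], which is small on the nodes; the product structure
   turns the l1 norm into l2 norms. *)
Lemma trig_product_diff_l1 t1 u1 J1 t2 u2 J2 N m eta :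
  0 < eta ->
  orthogonal_nodes t1 J1 N -> orthogonal_nodes t2 J2 N ->
  (forall i, (i <= J1)%nat -> Complex.Cmod (u1 i) * Rabs (t1 i) <= eta * Complex.Cmod (u1 i)) ->
  (forall i, (i <= J2)%nat -> Complex.Cmod (u2 i) * Rabs (t2 i) <= eta * Complex.Cmod (u2 i)) ->
  sum_n (fun n => Complex.Cmod
    (Cminus (Cmult (trig t1 u1 J1 (n + m)) (trig t2 u2 J2 (n + m)))
            (Cmult (trig t1 u1 J1 (S (n + m))) (trig t2 u2 J2 (S (n + m)))))) N
  <= INR (S N) * (eta * (sum_n (fun i => Complex.Cmod (u1 i) ^ 2) J1
                         + sum_n (fun i => Complex.Cmod (u2 i) ^ 2) J2)).
Proof.
  intros He Ho1 Ho2 H1 H2.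
  set (S1 := sum_n (fun i => Complex.Cmod (u1 i) ^ 2) J1).
  set (S2 := sum_n (fun i => Complex.Cmod (u2 i) ^ 2) J2).
  pose proof (parseval_diff_le t1 u1 J1 N m eta Ho1 H1) as D1.
  pose proof (parseval_diff_le t2 u2 J2 N m eta Ho2 H2) as D2.
  pose proof (parseval_shift t2 u2 J2 N m Ho2) as P2.
  pose proof (parseval_shift t1 u1 J1 N (S m) Ho1) as P1.
  fold S1 in D1, P1. fold S2 in D2, P2.
  set (d1 := fun n => Complex.Cmod (Cminus (trig t1 u1 J1 (n + m)) (trig t1 u1 J1 (S (n + m))))) in *.
  set (d2 := fun n => Complex.Cmod (Cminus (trig t2 u2 J2 (n + m)) (trig t2 u2 J2 (S (n + m))))) in *.
  set (a2 := fun n => Complex.Cmod (trig t2 u2 J2 (n + m))) in *.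
  set (a1 := fun n => Complex.Cmod (trig t1 u1 J1 (n + S m))) in *.
  change (sum_n (fun n => d1 n ^ 2) N <= INR (S N) * (eta ^ 2 * S1)) in D1.
  change (sum_n (fun n => d2 n ^ 2) N <= INR (S N) * (eta ^ 2 * S2)) in D2.
  change (sum_n (fun n => a1 n ^ 2) N = INR (S N) * S1) in P1.
  change (sum_n (fun n => a2 n ^ 2) N = INR (S N) * S2) in P2.
  apply Rle_trans with (sum_n (fun n =>
      plus (plus (/ (2 * eta) * d1 n ^ 2) (eta / 2 * a2 n ^ 2))
           (plus (/ (2 * eta) * d2 n ^ 2) (eta / 2 * a1 n ^ 2))) N).
  - apply sum_n_R_le; intros n _.
    set (A := trig t1 u1 J1 (n + m)). set (B := trig t2 u2 J2 (n + m)).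
    set (A' := trig t1 u1 J1 (S (n + m))). set (B' := trig t2 u2 J2 (S (n + m))).
    replace (Cminus (Cmult A B) (Cmult A' B'))
      with (Cplus (Cmult (Cminus A A') B) (Cmult (Cminus B B') A')) by ring.
    eapply Rle_trans; [apply Cmod_triangle|]. rewrite !Cmod_mult.
    pose proof (weighted_am_gm eta (d1 n) (a2 n) He) as HA.
    pose proof (weighted_am_gm eta (d2 n) (a1 n) He) as HB.
    replace (a1 n) with (Complex.Cmod A') in HB |- *
      by (unfold a1, A'; do 2 f_equal; lia).
    change (d1 n * a2 n + d2 n * Complex.Cmod A' <=
      (/ (2 * eta) * d1 n ^ 2 + eta / 2 * a2 n ^ 2) +
      (/ (2 * eta) * d2 n ^ 2 + eta / 2 * Complex.Cmod A' ^ 2)).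
    lra.
  - rewrite !sum_n_plus !sum_n_R_mult_l P1 P2.
    change (@plus _) with Rplus.
    assert (Hi : 0 < / (2 * eta)) by (apply Rinv_0_lt_compat; lra).
    apply (Rmult_le_compat_l _ _ _ (Rlt_le _ _ Hi)) in D1.
    apply (Rmult_le_compat_l _ _ _ (Rlt_le _ _ Hi)) in D2.
    replace (/ (2 * eta) * (INR (S N) * (eta ^ 2 * S1))) with (eta / 2 * (INR (S N) * S1)) in D1 by (field; lra).
    replace (/ (2 * eta) * (INR (S N) * (eta ^ 2 * S2))) with (eta / 2 * (INR (S N) * S2)) in D2 by (field; lra).
    lra.
Qed.

(** * Roots of unity and the cutoff near 1 *)

(** For [i < 2m] these are the arguments in [-pi, pi) of the 2m-th roots of unity; the root 1 sits
    at [i = m]. *)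
Definition theta (m i : nat) : R := PI * (INR i - INR m) / INR m.

Lemma INR_pos m : (0 < m)%nat -> 0 < INR m.
Proof. intros H. now apply lt_0_INR. Qed.

Lemma sum_cis_nodes m N i j :
  (0 < m)%nat -> S N = (2 * m)%nat -> (i <= N)%nat -> (j <= N)%nat -> i <> j ->
  sum_n (fun n => cis (INR n * (PI * (INR i - INR j) / INR m))) N = Complex.RtoC 0.
Proof.
  intros Hm HN Hi Hj Hij. pose proof (INR_pos m Hm) as Hmp. pose proof PI_RGT_0 as HP.
  assert (Hd : INR i - INR j <> 0) by (intros H; apply Hij, INR_eq; lra).
  assert (Hb : Rabs (INR i - INR j) < 2 * INR m).
  { assert (INR i < 2 * INR m) by (rewrite -[2]/(INR 2) -mult_INR; apply lt_INR; lia).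
    assert (INR j < 2 * INR m) by (rewrite -[2]/(INR 2) -mult_INR; apply lt_INR; lia).
    pose proof (pos_INR i). pose proof (pos_INR j). apply Rabs_def1; lra. }
  apply sum_cis_eq_0.
  - apply cis_neq_1.
    + unfold Rdiv. apply Rmult_integral_contrapositive; split.
      * apply Rmult_integral_contrapositive; split; lra.
      * apply Rinv_neq_0_compat; lra.
    + unfold Rdiv. rewrite Rabs_mult (Rabs_mult PI) (Rabs_right PI); [|lra].
      rewrite (Rabs_right (/ INR m)); [|apply Rle_ge, Rlt_le, Rinv_0_lt_compat; lra].
      apply Rmult_lt_reg_r with (INR m); [easy|].
      replace (PI * Rabs (INR i - INR j) * / INR m * INR m)
        with (PI * Rabs (INR i - INR j)) by (field; lra).
      nra.
  - rewrite HN mult_INR. simpl (INR 2).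
    replace ((1 + 1) * INR m * _) with (2 * PI * (INR i - INR j)) by (field; lra).
    apply cis_2PI_INR_minus.
Qed.

Lemma orthogonal_theta m N :
  (0 < m)%nat -> S N = (2 * m)%nat -> orthogonal_nodes (theta m) N N.
Proof.
  intros Hm HN i j Hi Hj Hij. pose proof (INR_pos m Hm).
  rewrite -(sum_cis_nodes m N i j Hm HN Hi Hj Hij). apply sum_n_ext; intros n.
  do 2 f_equal. unfold theta. field. lra.
Qed.

(** The dual orthogonality, in which the nodes are summed. The only multiple of [2m] between [m] and
    [3m] is [2m] itself; this range covers the frequencies [n + m] and [n + 1 + m] with [n < 2m]. *)
Lemma sum_cis_theta m N l :
  (0 < m)%nat -> S N = (2 * m)%nat -> (m <= l <= 3 * m)%nat ->
  sum_n (fun i => cis (INR l * theta m i)) N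
  = if Nat.eqb l (2 * m) then Complex.RtoC (INR (2 * m)) else Complex.RtoC 0.
Proof.
  intros Hm HN Hl. pose proof (INR_pos m Hm) as Hmp. pose proof PI_RGT_0 as HP.
  destruct (Nat.eqb_spec l (2 * m)) as [->|Hne].
  - transitivity (sum_n (fun _ => Complex.RtoC 1) N).
    + apply sum_n_ext; intros i. rewrite -(cis_2PI_INR_minus i m). f_equal.
      unfold theta. rewrite mult_INR. simpl (INR 2). field. lra.
    + rewrite sum_n_C_const HN. Cring.
  - transitivity (Cmult (cis (- (PI * INR l))) (sum_n (fun i => cis (INR i * (PI * INR l / INR m))) N)).
    + rewrite -sum_n_C_mult_l. apply sum_n_ext; intros i. rewrite -cis_plus. f_equal.
      unfold theta. field. lra.
    + rewrite sum_cis_eq_0; [Cring| |].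
      (* A full turn is removed to bring the angle into [-pi, pi], where [cis_neq_1] applies. *)
      * replace (PI * INR l / INR m) with (PI * (INR l / INR m - 2) + 2 * PI * INR 1)
          by (simpl; field; lra).
        rewrite cis_plus cis_2PI_INR.
        assert (H1 : INR m <= INR l) by (apply le_INR; lia).
        assert (H2 : INR l <= 3 * INR m) by (replace 3 with (INR 3) by (simpl; ring); rewrite -mult_INR; apply le_INR; lia).
        assert (H3 : INR l <> 2 * INR m).
        { intros H. apply Hne, INR_eq. now rewrite mult_INR. }
        assert (Hq : INR l / INR m * INR m = INR l) by (field; lra).
        set (q := INR l / INR m) in *.
        assert (1 <= q <= 3) by nra.
        assert (q <> 2) by nra.
        rewrite Cmult_1_r. apply cis_neq_1.
        -- apply Rmult_integral_contrapositive; split; lra.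
        -- rewrite Rabs_mult (Rabs_right PI); [|lra].
           assert (Rabs (q - 2) <= 1) by (apply Rabs_le; lra). nra.
      * rewrite HN -(cis_2PI_INR l) mult_INR. f_equal. simpl (INR 2). field. lra.
Qed.

(** The indicator of |i - m| <= 2p, written with additions because subtraction on [nat]
    truncates. *)
Definition window (m p i : nat) : R :=
  if andb (Nat.leb m (i + 2 * p)) (Nat.leb i (m + 2 * p)) then 1 else 0.

Lemma window_spec m p i :
  ((m <= i + 2 * p)%nat /\ (i <= m + 2 * p)%nat /\ window m p i = 1)
  \/ (((i + 2 * p < m)%nat \/ (m + 2 * p < i)%nat) /\ window m p i = 0).
Proof.
  unfold window. destruct (Nat.leb_spec m (i + 2 * p)); destruct (Nat.leb_spec i (m + 2 * p)); simpl; auto.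
Qed.

Lemma window_01 m p i : 0 <= window m p i <= 1.
Proof. destruct (window_spec m p i) as [(_ & _ & ->)|(_ & ->)]; lra. Qed.

Lemma sum_window m p n :
  (2 * p <= m)%nat ->
  sum_n (window m p) n = INR (Nat.min (S n) (S (m + 2 * p)) - (m - 2 * p)).
Proof.
  intros H. induction n as [|n IH].
  - rewrite sum_O. destruct (window_spec m p 0) as [(H1 & H2 & ->)|(H1 & ->)].
    + replace (_ - _)%nat with 1%nat by lia. reflexivity.
    + replace (_ - _)%nat with 0%nat by lia. reflexivity.
  - rewrite sum_n_R_S IH. destruct (window_spec m p (S n)) as [(H1 & H2 & ->)|(H1 & ->)].
    + rewrite -S_INR. f_equal. lia.
    + rewrite Rplus_0_r. f_equal. lia.
Qed.

Lemma sum_window_le m p n :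
  (2 * p <= m)%nat -> sum_n (window m p) n <= 4 * INR p + 1.
Proof.
  intros H. rewrite sum_window; [|easy].
  replace (4 * INR p + 1) with (INR (4 * p + 1)) by (rewrite plus_INR mult_INR; simpl; ring).
  apply le_INR. lia.
Qed.

(** The average of [p] one-sided translates of [window]: a trapezoid equal to 1 for |i - m| <= p and
    supported between [m - 3p + 1] and [m + 2p]. Being a convolution, it has a product as its
    transform. *)
Definition cutoff (m p i : nat) : R :=
  / INR p * sum_n (fun b => window m p (i + b)) (p - 1).

Lemma cutoff_01 m p i : (0 < p)%nat -> 0 <= cutoff m p i <= 1.
Proof.
  intros Hp. pose proof (INR_pos p Hp) as Hpp. unfold cutoff.
  assert (H0 : 0 <= sum_n (fun b => window m p (i + b)) (p - 1)).
  { rewrite -(Rmult_0_r (INR (S (p - 1)))) -sum_n_const.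
    apply sum_n_R_le; intros; apply window_01. }
  assert (H1 : sum_n (fun b => window m p (i + b)) (p - 1) <= INR p).
  { apply Rle_trans with (INR (S (p - 1)) * 1).
    - rewrite -sum_n_const. apply sum_n_R_le; intros; apply window_01.
    - replace (S (p - 1)) with p by lia. lra. }
  split.
  - apply Rmult_le_pos; [apply Rlt_le, Rinv_0_lt_compat; lra|easy].
  - apply Rmult_le_reg_l with (INR p); [easy|].
    rewrite -Rmult_assoc Rinv_r; lra.
Qed.

Lemma cutoff_near m p i :
  (0 < p)%nat -> (m <= i + p)%nat -> (i <= m + p)%nat -> cutoff m p i = 1.
Proof.
  intros Hp H1 H2. pose proof (INR_pos p Hp) as Hpp. unfold cutoff.
  rewrite (sum_n_ext_loc _ (fun _ => 1)).
  - rewrite sum_n_const. replace (S (p - 1)) with p by lia.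
    rewrite Rmult_1_r. apply Rinv_l. lra.
  - intros b Hb. destruct (window_spec m p (i + b)) as [(_ & _ & ->)|([H|H] & _)]; [easy|lia|lia].
Qed.

(** The differences telescope to [window m p i - window m p (i + p)], which lies in [-1, 1]. *)
Lemma cutoff_step m p i :
  (0 < p)%nat -> Rabs (cutoff m p i - cutoff m p (S i)) <= / INR p.
Proof.
  intros Hp. pose proof (INR_pos p Hp) as Hpp. unfold cutoff.
  assert (Ht : forall n, sum_n (fun b => window m p (i + b)) n
     - sum_n (fun b => window m p (S i + b)) n = window m p i - window m p (i + S n)).
  { induction n as [|n IH].
    - rewrite !sum_O. rewrite Nat.add_0_r. do 2 f_equal. lia.
    - rewrite !sum_n_R_S. replace (S i + S n)%nat with (i + S (S n))%nat by lia. lra. }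
  rewrite -Rmult_minus_distr_l Ht Rabs_mult Rabs_right;
    [|apply Rle_ge, Rlt_le, Rinv_0_lt_compat; lra].
  apply Rle_trans with (/ INR p * 1); [|lra].
  apply Rmult_le_compat_l; [apply Rlt_le, Rinv_0_lt_compat; lra|].
  pose proof (window_01 m p i). pose proof (window_01 m p (i + S (p - 1))).
  apply Rabs_le. lra.
Qed.

(** The transform of a convolution is the product of the transforms. Since [3 p <= m], no translate
    of the window leaves the index range. *)
Lemma trig_cutoff m p N l :
  (0 < p)%nat -> (3 * p <= m)%nat -> S N = (2 * m)%nat ->
  Cmult (Complex.RtoC (INR p)) (trig (theta m) (fun i => Complex.RtoC (cutoff m p i)) N l)
  = Cmult (trig (fun b => - (PI * INR b / INR m)) (fun _ => Complex.RtoC 1) (p - 1) l)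
          (trig (theta m) (fun i => Complex.RtoC (window m p i)) N l).
Proof.
  intros Hp H3 HN.
  assert (Hpp : 0 < INR p) by (apply INR_pos; lia).
  assert (Hmp : 0 < INR m) by (apply INR_pos; lia).
  transitivity (sum_n (fun i => sum_n (fun b =>
     Cmult (Complex.RtoC (window m p (i + b))) (cis (INR l * theta m i))) (p - 1)) N).
  - unfold trig. rewrite -sum_n_C_mult_l. apply sum_n_ext; intros i.
    rewrite sum_n_C_mult_r sum_n_RtoC Cmult_assoc -RtoC_mult. do 2 f_equal.
    unfold cutoff. rewrite -Rmult_assoc Rinv_r; [|lra]. now rewrite Rmult_1_l.
  - rewrite sum_n_switch. unfold trig at 1. rewrite -sum_n_C_mult_r.
    apply sum_n_ext_loc; intros b Hb. rewrite Cmult_1_l.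
    set (F := fun i => Cmult (cis (INR l * - (PI * INR b / INR m)))
       (Cmult (Complex.RtoC (window m p i)) (cis (INR l * theta m i)))).
    transitivity (sum_n (fun i => F (i + b)%nat) N).
    + apply sum_n_ext; intros i. unfold F.
      replace (INR l * theta m i) with (INR l * - (PI * INR b / INR m) + INR l * theta m (i + b))
        by (unfold theta; rewrite plus_INR; field; lra).
      rewrite cis_plus. Cring.
    + assert (HF : forall i, window m p i = 0 -> F i = (Complex.RtoC 0)).
      { intros i Hi. unfold F. rewrite Hi. ring. }
      etransitivity; [apply (sum_n_shift C_AbelianGroup F)|].
      * intros i Hi. apply HF. destruct (window_spec m p i) as [(H & _)|(_ & ->)]; [lia|easy].
      * intros i Hi. apply HF. destruct (window_spec m p i) as [(_ & H & _)|(_ & ->)]; [lia|easy].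
      * unfold F, trig. now rewrite -sum_n_C_mult_l.
Qed.

Lemma orthogonal_tau m N p :
  (0 < m)%nat -> S N = (2 * m)%nat -> (p <= m)%nat ->
  orthogonal_nodes (fun b => - (PI * INR b / INR m)) (p - 1) N.
Proof.
  intros Hm HN Hp i j Hi Hj Hij. pose proof (INR_pos m Hm).
  rewrite -(sum_cis_nodes m N j i Hm HN ltac:(lia) ltac:(lia) ltac:(lia)).
  apply sum_n_ext; intros n. do 2 f_equal. field. lra.
Qed.

(** With z = [cis (theta m i)] this is z^m (1 - z). As z^(2m) = 1, the mean of z^m z^n over the
    roots is 1 for n = m and 0 for every other n < 2m. *)
Definition extraction_weight (m i : nat) : C :=
  Cminus (cis (INR m * theta m i)) (cis (INR (S m) * theta m i)).

(** The inner sum is a difference of consecutive Fourier coefficients of the cutoff, which are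
    products, so [trig_product_diff_l1] applies with an [eta] bounding the angles of both factors.
    The square sums of the masses are [p] and at most [4p + 1], together at most [6p]; the factor
    [1/p] of the average leaves 6. *)
Lemma cutoff_coeff_l1 m p N :
  (0 < p)%nat -> (3 * p <= m)%nat -> S N = (2 * m)%nat ->
  sum_n (fun n => Complex.Cmod (sum_n (fun i =>
     Cmult (Cmult (extraction_weight m i) (Complex.RtoC (cutoff m p i)))
           (cis (INR n * theta m i))) N)) N
  <= INR (S N) * (6 * (2 * PI * INR p / INR m)).
Proof.
  intros Hp H3 HN.
  assert (Hpp : 1 <= INR p) by (apply (le_INR 1); lia).
  assert (Hmp : 0 < INR m) by (apply INR_pos; lia).
  pose proof PI_RGT_0 as HP.
  set (eta := 2 * PI * INR p / INR m).
  assert (He : 0 < eta) by (apply Rdiv_lt_0_compat; nra).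
  set (tau := fun b => - (PI * INR b / INR m)).
  set (V := fun i => Complex.RtoC (cutoff m p i)).
  pose proof (trig_product_diff_l1 tau (fun _ => Complex.RtoC 1) (p - 1)
     (theta m) (fun i => Complex.RtoC (window m p i)) N N m eta He
     ltac:(apply orthogonal_tau; lia) ltac:(apply orthogonal_theta; lia)) as HL.
  assert (Hin : INR p * sum_n (fun n => Complex.Cmod (sum_n (fun i =>
     Cmult (Cmult (extraction_weight m i) (V i)) (cis (INR n * theta m i))) N)) N
     <= INR (S N) * (eta * (INR p + (4 * INR p + 1)))).
  { rewrite -sum_n_R_mult_l. eapply Rle_trans; [|eapply Rle_trans; [apply HL|]]; clear HL.
    - apply Req_le. apply sum_n_ext; intros n.
      unfold tau. rewrite -!trig_cutoff; try lia.
      rewrite -{1}(Rabs_right (INR p)); [|lra].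
      rewrite -Cmod_R -Cmod_mult. f_equal.
      match goal with |- _ = ?r => transitivity (Cmult (Complex.RtoC (INR p))
        (Cminus (trig (theta m) V N (n + m)) (trig (theta m) V N (S (n + m))))); [|unfold V; Cring] end.
      f_equal. unfold trig. rewrite -sum_n_C_minus. apply sum_n_ext; intros i.
      unfold extraction_weight. rewrite !S_INR plus_INR !Rmult_plus_distr_r !cis_plus. Cring.
    - intros b Hb. rewrite Cmod_1 Rmult_1_l Rmult_1_r. unfold tau, eta.
      rewrite Rabs_Ropp. unfold Rdiv.
      pose proof (pos_INR b).
      assert (INR b <= INR p) by (apply le_INR; lia).
      rewrite Rabs_right.
      + apply Rmult_le_compat_r; [apply Rlt_le, Rinv_0_lt_compat; lra|]. nra.
      + apply Rle_ge, Rmult_le_pos; [nra|apply Rlt_le, Rinv_0_lt_compat; lra].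
    - intros i Hi. rewrite Cmod_R Rabs_right; [|apply Rle_ge, window_01].
      destruct (window_spec m p i) as [(H1 & H2 & ->)|(_ & ->)]; [|lra].
      rewrite Rmult_1_l Rmult_1_r. unfold theta, eta, Rdiv. rewrite Rabs_mult.
      rewrite (Rabs_right (/ INR m)); [|apply Rle_ge, Rlt_le, Rinv_0_lt_compat; lra].
      apply Rmult_le_compat_r; [apply Rlt_le, Rinv_0_lt_compat; lra|].
      rewrite Rabs_mult (Rabs_right PI); [|lra].
      apply le_INR in H1. apply le_INR in H2.
      rewrite plus_INR mult_INR /= in H1. rewrite plus_INR mult_INR /= in H2.
      assert (Rabs (INR i - INR m) <= 2 * INR p) by (apply Rabs_le; lra). nra.
    - apply Rmult_le_compat_l; [apply pos_INR|]. apply Rmult_le_compat_l; [lra|].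
      apply Rplus_le_compat.
      + apply Req_le. rewrite Cmod_1 pow1 sum_n_const. rewrite Rmult_1_r. f_equal. lia.
      + eapply Rle_trans; [|apply (sum_window_le m p N); lia].
        apply sum_n_R_le; intros i _. rewrite Cmod_R Rabs_right; [|apply Rle_ge, window_01].
        pose proof (window_01 m p i). nra. }
  apply Rmult_le_reg_l with (INR p); [lra|].
  eapply Rle_trans; [exact Hin|].
  pose proof (pos_INR (S N)).
  assert (0 <= INR (S N) * eta) by nra. nra.
Qed.

(** * The resolvent on the unit circle *)

Lemma minus_plus_plus (G : AbelianGroup) (a b c d : G) :
  minus (plus a b) (plus c d) = plus (minus a c) (minus b d).
Proof.
  unfold minus. rewrite opp_plus -!plus_assoc. f_equal.
  rewrite !plus_assoc. f_equal. apply plus_comm.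
Qed.

Lemma plus_minus_cancel (G : AbelianGroup) (a b c d : G) :
  plus (minus a b) (minus (plus b c) d) = minus (plus a c) d.
Proof.
  unfold minus. rewrite !plus_assoc. do 2 f_equal.
  now rewrite -(plus_assoc a) plus_opp_l plus_zero_r.
Qed.

Lemma sum_n_pairs (G : AbelianMonoid) (f : nat -> G) k :
  sum_n f (2 * k + 1) = sum_n (fun j => plus (f (2 * j)%nat) (f (2 * j + 1)%nat)) k.
Proof.
  induction k as [|k IH].
  - rewrite sum_O sum_Sn sum_O. reflexivity.
  - replace (2 * S k + 1)%nat with (S (S (2 * k + 1))) by lia.
    rewrite !sum_Sn IH -plus_assoc.
    replace (S (2 * k + 1)) with (2 * S k)%nat by lia.
    now replace (S (2 * S k)) with (2 * S k + 1)%nat by lia.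
Qed.

(** The operator 1 - zT at z = [cis t], that is z (1/z - T), invertible when [cis (- t)] is outside
    the spectrum. *)
Definition res_op {X : CBanach} (T : X -> X) (t : R) (z : X) : X :=
  minus z (scal (cis t) (T z)).

Section Operator.
Context {X : CBanach} (T : X -> X).
Hypothesis HT : bounded_linear T.

Lemma bounded_linear_plus (x y : X) : T (plus x y) = plus (T x) (T y).
Proof. destruct HT as [H _]. exact (H x y). Qed.

Lemma bounded_linear_scal (c : C) (x : X) : T (scal c x) = scal c (T x).
Proof. destruct HT as [_ [H _]]. exact (H (to_Cpx c) x). Qed.

Lemma bounded_linear_bound : exists tau, 0 <= tau /\ forall x, vnorm (T x) <= tau * vnorm x.
Proof.
  destruct HT as [_ [_ [M HM]]]. exists (Rmax M 0). split; [apply Rmax_r|].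
  intros x. eapply Rle_trans; [apply HM|].
  apply Rmult_le_compat_r; [apply vnorm_ge_0|apply Rmax_l].
Qed.

Lemma res_op_plus t (x y : X) : res_op T t (plus x y) = plus (res_op T t x) (res_op T t y).
Proof. unfold res_op. now rewrite bounded_linear_plus scal_distr_l minus_plus_plus. Qed.

Lemma res_op_scal t c (x : X) : res_op T t (scal c x) = scal c (res_op T t x).
Proof.
  unfold res_op. rewrite bounded_linear_scal scal_minus_distr_l !scal_assoc. do 2 f_equal.
  Cring.
Qed.

Lemma res_op_opp t (x : X) : res_op T t (opp x) = opp (res_op T t x).
Proof. now rewrite -(scal_opp_one x) res_op_scal scal_opp_one. Qed.

Lemma res_op_minus t (x y : X) : res_op T t (minus x y) = minus (res_op T t x) (res_op T t y).
Proof. unfold minus. now rewrite res_op_plus res_op_opp. Qed.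

(** A change of angle is a perturbation by a small multiple of [T]; the compactness argument and the
    Lipschitz bound for the resolvent both rest on it. *)
Lemma res_op_move t t' (x : X) :
  res_op T t x = plus (res_op T t' x) (scal (Cminus (cis t') (cis t)) (T x)).
Proof.
  unfold res_op. change (Cminus (cis t') (cis t)) with (minus (cis t' : C_Ring) (cis t)).
  rewrite scal_minus_distr_r -[scal (cis t') (T x)]plus_zero_r.
  unfold minus. rewrite -plus_assoc. f_equal.
  rewrite plus_zero_r plus_assoc plus_opp_l plus_zero_l. reflexivity.
Qed.

Definition partial_transform (s : nat -> X) (N : nat) (t : R) : X :=
  sum_n (fun n => scal (cis (INR n * t)) (s n)) N.

(** By the recurrence, the term z^(n+1) T s(n) left over at stage [n] cancels against z^(n+1)
    s(n+1), up to a multiple of [x]; only the last one survives. *)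
Lemma res_op_partial_transform (ka : nat -> R) (x : X) (s : nat -> X) N t :
  s 0%nat = scal (Complex.RtoC (ka 0%nat)) x ->
  (forall n, s (S n) = plus (T (s n)) (scal (Complex.RtoC (ka (S n))) x)) ->
  res_op T t (partial_transform s N t)
  = minus (scal (sum_n (fun n => Cmult (Complex.RtoC (ka n)) (cis (INR n * t))) N) x)
          (scal (cis (INR (S N) * t)) (T (s N))).
Proof.
  intros H0 HS. unfold partial_transform. induction N as [|N IH].
  - rewrite !sum_O res_op_scal. unfold res_op. simpl INR.
    rewrite Rmult_0_l Rmult_1_l cis_0 Cmult_1_r scal_one -H0. reflexivity.
  - rewrite !sum_Sn res_op_plus IH res_op_scal. clear IH.
    generalize (sum_n (fun n => Cmult (Complex.RtoC (ka n)) (cis (INR n * t))) N).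
    intros kap. unfold res_op at 1.
    rewrite scal_minus_distr_l {1}HS scal_distr_l plus_minus_cancel.
    rewrite !scal_assoc (scal_distr_r kap). f_equal.
    + do 2 f_equal. Cring.
    + f_equal. rewrite (S_INR (S N)) Rmult_plus_distr_r Rmult_1_l cis_plus. Cring.
Qed.

Lemma sum_scal_partial_transform (a : nat -> C) (t : nat -> R) (s : nat -> X) J N :
  sum_n (fun i => scal (a i) (partial_transform s N (t i))) J
  = sum_n (fun n => scal (sum_n (fun i => Cmult (a i) (cis (INR n * t i))) J) (s n)) N.
Proof.
  transitivity (sum_n (fun i => sum_n (fun n =>
     scal (Cmult (a i) (cis (INR n * t i))) (s n)) N) J).
  - apply sum_n_ext; intros i. unfold partial_transform. rewrite -sum_n_scal_l.
    apply sum_n_ext; intros n. now rewrite scal_assoc.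
  - rewrite sum_n_switch. apply sum_n_ext; intros n.
    apply (scal_sum_n_l C_Ring).
Qed.

(** A lower bound with constant B at one angle persists, with 2B, at distance below 1 / (2 B (tau +
    1)), because the perturbation is absorbed by half the norm of [z]. Compactness then supplies one
    radius [d] below those of the angles used. *)
Lemma res_op_lower_bound_compact (a b : R) :
  (forall t, a <= t <= b -> exists B, 0 < B /\ forall z, vnorm z <= B * vnorm (res_op T t z)) ->
  exists B, 0 < B /\ forall t, a <= t <= b -> forall z, vnorm z <= B * vnorm (res_op T t z).
Proof.
  intros H. destruct bounded_linear_bound as [tau [Htau HTb]].
  set (Bf := fun t => epsilon (inhabits 1) (fun B =>
      0 < B /\ forall z, vnorm z <= B * vnorm (res_op T t z))).
  assert (HB : forall t, a <= t <= b ->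
      0 < Bf t /\ forall z, vnorm z <= Bf t * vnorm (res_op T t z)).
  { intros t Ht. exact (epsilon_spec (inhabits 1) _ (H t Ht)). }
  (* Outside [a, b] nothing is known of [Bf t], yet the radius must be positive everywhere; hence
     [Rmax] with 1. The 1 added to [tau] covers [tau = 0]. *)
  assert (Hd : forall t, 0 < / (2 * Rmax (Bf t) 1 * (tau + 1))).
  { intros t. apply Rinv_0_lt_compat. pose proof (Rmax_r (Bf t) 1). nra. }
  destruct (compactness_value_1d a b (fun t => mkposreal _ (Hd t))) as [d Hcov].
  (* From [d <= 1 / (2 b' (tau + 1))] follows [2 b' <= 1 / (d (tau + 1))]. *)
  exists (/ (d * (tau + 1))).
  assert (Hdpos : 0 < d * (tau + 1)) by (pose proof (cond_pos d); nra).
  split; [now apply Rinv_0_lt_compat|].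
  intros t Ht z. specialize (Hcov t Ht). apply NNPP in Hcov.
  destruct Hcov as [t' [Ht' [Hdist Hdle]]]. simpl in Hdist, Hdle.
  destruct (HB t' Ht') as [HBpos HBz].
  set (b' := Rmax (Bf t') 1) in *.
  assert (Hb1 : 1 <= b') by apply Rmax_r.
  assert (Hlow : vnorm z <= b' * vnorm (res_op T t' z)).
  { eapply Rle_trans; [apply HBz|]. apply Rmult_le_compat_r; [apply vnorm_ge_0|apply Rmax_l]. }
  rewrite (res_op_move t' t) in Hlow.
  assert (Hz := vnorm_ge_0 X z).
  assert (Hp : vnorm (plus (res_op T t z) (scal (Cminus (cis t) (cis t')) (T z)))
     <= vnorm (res_op T t z) + / (2 * b' * (tau + 1)) * (tau * vnorm z)).
  { eapply Rle_trans; [apply vnorm_plus|]. apply Rplus_le_compat_l.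
    rewrite vnorm_scal_C. apply Rmult_le_compat; try apply Cmod_ge_0; try apply vnorm_ge_0; [|apply HTb].
    pose proof (Cmod_cis_minus t t'). lra. }
  assert (Hq : b' * (/ (2 * b' * (tau + 1)) * (tau * vnorm z)) <= / 2 * vnorm z).
  { replace (b' * (/ (2 * b' * (tau + 1)) * (tau * vnorm z)))
      with (/ 2 * (tau * / (tau + 1)) * vnorm z) by (field; lra).
    apply Rmult_le_compat_r; [easy|].
    assert (tau * / (tau + 1) <= 1).
    { apply Rmult_le_reg_r with (tau + 1); [lra|]. rewrite Rmult_assoc Rinv_l; lra. }
    lra. }
  set (u := vnorm (res_op T t z)) in *.
  assert (Hu : 0 <= u) by apply vnorm_ge_0.
  assert (Hfin : vnorm z <= 2 * b' * u).
  { assert (b' * vnorm (plus (res_op T t z) (scal (Cminus (cis t) (cis t')) (T z)))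
       <= b' * (u + / (2 * b' * (tau + 1)) * (tau * vnorm z))) by (apply Rmult_le_compat_l; lra).
    lra. }
  eapply Rle_trans; [exact Hfin|]. apply Rmult_le_compat_r; [easy|].
  apply Rmult_le_reg_r with (d * (tau + 1)); [easy|].
  rewrite Rinv_l; [|lra].
  apply (Rmult_le_compat_l (2 * b' * (tau + 1))) in Hdle; [|nra].
  rewrite Rinv_r in Hdle; [|nra]. lra.
Qed.

(** [cis (- t)] lies on the unit circle and differs from 1, so it is outside the spectrum. The
    inverse of [cis (- t) - T] yields the lower bound by its boundedness, and the preimages. *)
Lemma res_op_invertible t :
  (forall l : Cpx, Defs.Cmod l = 1 -> in_spectrum T l -> l = Cx1) ->
  cis t <> Complex.RtoC 1 ->
  (exists B, 0 < B /\ forall z, vnorm z <= B * vnorm (res_op T t z)) /\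
  (forall y, exists z, res_op T t z = y).
Proof.
  intros Hs Ht.
  assert (HE : Cmult (cis t) (cis (- t)) = Complex.RtoC 1).
  { rewrite -cis_plus Rplus_opp_r. apply cis_0. }
  assert (Hnot : ~ in_spectrum T (to_Cpx (cis (- t)))).
  { intros Hin. apply Ht. apply Hs in Hin.
    - unfold to_Cpx, Cx1 in Hin. injection Hin as Hc Hsn. simpl in Hc, Hsn.
      rewrite cos_neg in Hc. rewrite sin_neg in Hsn.
      unfold cis. rewrite Hc. replace (sin t) with 0 by lra. reflexivity.
    - exact (Cmod_cis (- t)). }
  apply NNPP in Hnot. destruct Hnot as [S [[Sp [Ss [M HM]]] [HS1 HS2]]].
  assert (Hres : forall z, res_op T t z = scal (cis t) (minus (scal (cis (- t)) z) (T z))).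
  { intros z. unfold res_op. rewrite scal_minus_distr_l scal_assoc.
    change (mult (cis t : C_Ring) (cis (- t))) with (Cmult (cis t) (cis (- t))). rewrite HE.
    now rewrite scal_one. }
  split.
  - exists (Rmax M 1). split; [pose proof (Rmax_r M 1); lra|].
    intros z. rewrite Hres vnorm_scal_C Cmod_cis Rmult_1_l.
    rewrite -{1}(HS1 z). eapply Rle_trans; [apply HM|].
    apply Rmult_le_compat_r; [apply vnorm_ge_0|apply Rmax_l].
  - intros y. exists (S (scal (cis (- t)) y)). rewrite Hres.
    transitivity (scal (cis t) (scal (cis (- t)) y)).
    + f_equal. exact (HS2 (scal (cis (- t)) y)).
    + rewrite scal_assoc. change (mult (cis t : C_Ring) (cis (- t))) with (Cmult (cis t) (cis (- t))).
      rewrite HE. exact (scal_one y).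
Qed.

End Operator.

(** * The difference of consecutive Cesaro sums *)

Lemma sum_n_minus (G : AbelianGroup) (f g : nat -> G) n :
  sum_n (fun i => minus (f i) (g i)) n = minus (sum_n f n) (sum_n g n).
Proof.
  induction n as [|n IH].
  - now rewrite !sum_O.
  - now rewrite !sum_Sn IH minus_plus_plus.
Qed.

Lemma cis_PI x : cis (x + PI) = Copp (cis x).
Proof. unfold cis. rewrite neg_cos neg_sin. reflexivity. Qed.

Lemma extraction_weight_factor m i :
  extraction_weight m i
  = Cmult (cis (INR m * theta m i)) (Cminus (cis 0) (cis (theta m i))).
Proof.
  unfold extraction_weight. rewrite S_INR Rmult_plus_distr_r Rmult_1_l cis_plus cis_0. ring.
Qed.

Lemma sum_extraction_weight m N n :
  (0 < m)%nat -> S N = (2 * m)%nat -> (n <= N)%nat ->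
  sum_n (fun i => Cmult (extraction_weight m i) (cis (INR n * theta m i))) N
  = Cminus (if Nat.eqb n m then Complex.RtoC (INR (S N)) else Complex.RtoC 0)
           (if Nat.eqb n (m - 1) then Complex.RtoC (INR (S N)) else Complex.RtoC 0).
Proof.
  intros Hm HN Hn.
  transitivity (Cminus (sum_n (fun i => cis (INR (n + m) * theta m i)) N)
                       (sum_n (fun i => cis (INR (S n + m) * theta m i)) N)).
  - rewrite -sum_n_C_minus. apply sum_n_ext; intros i. unfold extraction_weight.
    rewrite !plus_INR !S_INR !Rmult_plus_distr_r !cis_plus. Cring.
  - rewrite !(sum_cis_theta m N) ?HN; try lia.
    replace (Nat.eqb (n + m) (2 * m)) with (Nat.eqb n m).
    + now replace (Nat.eqb (S n + m) (2 * m)) with (Nat.eqb n (m - 1))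
        by (destruct (Nat.eqb_spec n (m - 1)); destruct (Nat.eqb_spec (S n + m) (2 * m)); lia).
    + destruct (Nat.eqb_spec n m); destruct (Nat.eqb_spec (n + m) (2 * m)); lia.
Qed.

Lemma difference_extraction (X : CBanach) (s : nat -> X) m N :
  (0 < m)%nat -> S N = (2 * m)%nat ->
  scal (Complex.RtoC (INR (S N))) (minus (s m) (s (m - 1)%nat))
  = sum_n (fun i => scal (extraction_weight m i) (partial_transform s N (theta m i))) N.
Proof.
  intros Hm HN. rewrite sum_scal_partial_transform.
  rewrite (sum_n_ext_loc _ (fun n => minus
     (scal (if Nat.eqb n m then Complex.RtoC (INR (S N)) else (zero : C_Ring)) (s n))
     (scal (if Nat.eqb n (m - 1) then Complex.RtoC (INR (S N)) else (zero : C_Ring)) (s n)))).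
  - rewrite sum_n_minus !(sum_n_kronecker C_Ring); try lia.
    exact (scal_minus_distr_l (Complex.RtoC (INR (S N))) (s m) (s (m - 1)%nat)).
  - intros n Hn. rewrite sum_extraction_weight; try lia. exact (scal_minus_distr_r _ _ (s n)).
Qed.

Lemma theta_step m i : (0 < m)%nat -> theta m (S i) = theta m i + PI / INR m.
Proof.
  intros Hm. pose proof (INR_pos m Hm). unfold theta. rewrite S_INR. field. lra.
Qed.

Lemma extraction_sign_step m i :
  (0 < m)%nat -> cis (INR m * theta m (S i)) = Copp (cis (INR m * theta m i)).
Proof.
  intros Hm. pose proof (INR_pos m Hm). rewrite -cis_PI theta_step; [|easy]. f_equal. field. lra.
Qed.

Lemma theta_far m p N i :
  (0 < m)%nat -> S N = (2 * m)%nat -> (i <= N)%nat ->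
  (i + p <= m)%nat \/ (m + p <= i)%nat ->
  PI * INR p / INR m <= Rabs (theta m i) <= PI.
Proof.
  intros Hm HN Hi Hfar. pose proof (INR_pos m Hm) as Hmp. pose proof PI_RGT_0.
  assert (Hinv : 0 < / INR m) by now apply Rinv_0_lt_compat.
  unfold theta, Rdiv. rewrite Rabs_mult (Rabs_mult PI) (Rabs_right PI); [|lra].
  rewrite (Rabs_right (/ INR m)); [|lra].
  assert (H1 : INR p <= Rabs (INR i - INR m)).
  { destruct Hfar as [Hf|Hf]; apply le_INR in Hf; rewrite plus_INR in Hf.
    - rewrite Rabs_left1; pose proof (pos_INR p); lra.
    - rewrite Rabs_right; pose proof (pos_INR p); lra. }
  assert (H2 : Rabs (INR i - INR m) <= INR m).
  { assert (Hi2 : (i <= 2 * m)%nat) by lia. apply le_INR in Hi2.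
    rewrite mult_INR in Hi2. simpl (INR 2) in Hi2. pose proof (pos_INR i). apply Rabs_le. lra. }
  split.
  - apply Rmult_le_compat_r; [lra|]. nra.
  - apply Rmult_le_reg_r with (INR m); [easy|]. rewrite Rmult_assoc Rinv_l; [|lra]. nra.
Qed.

(* [partial_transform s N] agrees on the [2 m]-th roots of unity with
   [(1 - cis t T)^-1 (kappa x - T (s N))]; the first part of the bound comes from
   the roots near [1], the second from [kappa x], and the third from the
   oscillation of [cis (m theta_i)] against the slowly varying resolvent. *)
Lemma difference_bound (X : CBanach) (T : X -> X) (ka : nat -> R) (x : X) (s : nat -> X)
    (m p N : nat) (B tau L kb : R) :
  bounded_linear T ->
  s 0%nat = scal (Complex.RtoC (ka 0%nat)) x ->
  (forall n, s (S n) = plus (T (s n)) (scal (Complex.RtoC (ka (S n))) x)) ->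
  (0 < p)%nat -> (3 * p <= m)%nat -> S N = (2 * m)%nat ->
  0 < B -> 0 <= tau -> (forall z, vnorm (T z) <= tau * vnorm z) ->
  (forall t, PI * INR p / INR m <= Rabs t <= PI ->
     (forall z, vnorm z <= B * vnorm (res_op T t z)) /\
     (forall y, exists z, res_op T t z = y)) ->
  (forall n, (n <= N)%nat -> vnorm (s n) <= L) ->
  vnorm x <= 1 ->
  (forall t, Complex.Cmod (Cminus (cis 0) (cis t)) *
     Complex.Cmod (sum_n (fun n => Cmult (Complex.RtoC (ka n)) (cis (INR n * t))) N) <= kb) ->
  vnorm (minus (s m) (s (m - 1)%nat))
  <= 6 * (2 * PI * INR p / INR m) * L + B * kb
     + / 2 * ((PI / INR m + 2 * / INR p) * B + 2 * (B * (PI / INR m * (tau * B)))) * (tau * L).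
Proof.
  intros HT H0 HS Hp H3 HN HB Htau HTb Hres HL Hx Hkb.
  assert (Hm : (0 < m)%nat) by lia.
  pose proof (INR_pos m Hm) as Hmp. pose proof (INR_pos p Hp) as Hpp. pose proof PI_RGT_0 as HP.
  assert (HMp : INR (S N) = 2 * INR m) by (rewrite HN mult_INR; reflexivity).
  set (far := fun i => (i + p <= m)%nat \/ (m + p <= i)%nat).
  set (V := cutoff m p).
  assert (HV : forall i, 0 <= V i <= 1) by (intros i; now apply cutoff_01).
  assert (Hnear : forall i, (m <= i + p)%nat -> (i <= m + p)%nat -> V i = 1)
    by (intros; now apply cutoff_near).
  set (a := extraction_weight m). set (Pi := fun i => partial_transform s N (theta m i)).
  set (y := T (s N)).
  assert (Hy : vnorm y <= tau * L).
  { eapply Rle_trans; [apply HTb|]. apply Rmult_le_compat_l; [easy|]. apply HL; lia. }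
  pose proof (vnorm_ge_0 X y) as Hy0.
  (* The resolvent applied to [T (s N)]. A default value of [epsilon] can occur only at roots near
     1, where the cutoff is 1. *)
  set (r := fun i => epsilon (inhabits (zero : X)) (fun z => res_op T (theta m i) z = y)).
  assert (Hr : forall i, (i <= N)%nat -> far i -> res_op T (theta m i) (r i) = y).
  { intros i Hi Hf.
    destruct (Hres (theta m i) (theta_far m p N i Hm HN Hi Hf)) as [_ Hex].
    exact (epsilon_spec (inhabits (zero : X)) _ (Hex y)). }
  assert (Hlow : forall i, (i <= N)%nat -> far i ->
     forall z, vnorm z <= B * vnorm (res_op T (theta m i) z)).
  { intros i Hi Hf. apply (Hres (theta m i) (theta_far m p N i Hm HN Hi Hf)). }
  assert (Hrn : forall i, (i <= N)%nat -> far i -> vnorm (r i) <= B * vnorm y).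
  { intros i Hi Hf. rewrite -(Hr i Hi Hf). now apply Hlow. }
  (* At a root of unity (1 - zT) P(z) = kappa(z) x - T s(N), since z^(2m) = 1. Away from 1, adding
     [r i] therefore leaves the resolvent applied to kappa(z) x. *)
  set (q := fun i => plus (Pi i) (r i)).
  set (W := fun i => Complex.RtoC (1 - V i)).
  assert (HW : forall i, Complex.Cmod (W i) = 1 - V i).
  { intros i. unfold W. rewrite Cmod_R Rabs_right; [easy|]. specialize (HV i). lra. }
  assert (Ha : forall i, Complex.Cmod (a i) = Complex.Cmod (Cminus (cis 0) (cis (theta m i)))).
  { intros i. unfold a. rewrite extraction_weight_factor Cmod_mult Cmod_cis. ring. }
  (* P is split as V P + (1 - V) P, with P = q - r in the second part. *)
  assert (Hsplit : scal (Complex.RtoC (INR (S N))) (minus (s m) (s (m - 1)%nat))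
    = plus (sum_n (fun i => scal (Cmult (a i) (Complex.RtoC (V i))) (Pi i)) N)
        (minus (sum_n (fun i => scal (Cmult (a i) (W i)) (q i)) N)
               (sum_n (fun i => scal (Cmult (a i) (W i)) (r i)) N))).
  { rewrite (difference_extraction X s m N Hm HN) -sum_n_minus -sum_n_plus.
    apply sum_n_ext; intros i. fold (a i). fold (Pi i).
    rewrite -scal_minus_distr_l. unfold q, minus. rewrite -plus_assoc plus_opp_r plus_zero_r.
    rewrite -scal_distr_r. f_equal. unfold W.
    rewrite RtoC_minus. Cring. }
  assert (B1 : vnorm (sum_n (fun i => scal (Cmult (a i) (Complex.RtoC (V i))) (Pi i)) N)
     <= INR (S N) * (6 * (2 * PI * INR p / INR m)) * L).
  (* Exchanging the sums pairs the Fourier coefficients of the cut-off weight with the [s n], so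
     that their l1 norm meets the bound [L]. *)
  { unfold Pi. rewrite sum_scal_partial_transform. eapply Rle_trans; [apply vnorm_sum_n|].
    eapply Rle_trans; [|apply Rmult_le_compat_r; [|apply (cutoff_coeff_l1 m p N Hp H3 HN)]].
    - rewrite Rmult_comm -sum_n_R_mult_l. apply sum_n_R_le; intros n Hn.
      rewrite vnorm_scal_C Rmult_comm. apply Rmult_le_compat_r; [apply Cmod_ge_0|now apply HL].
    - eapply Rle_trans; [apply (vnorm_ge_0 X (s 0%nat))|apply HL; lia]. }
  assert (B2 : vnorm (sum_n (fun i => scal (Cmult (a i) (W i)) (q i)) N) <= INR (S N) * (B * kb)).
  { eapply Rle_trans; [apply vnorm_sum_n|]. rewrite -sum_n_const.
    apply sum_n_R_le; intros i Hi. rewrite vnorm_scal_C Cmod_mult HW Ha.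
    specialize (HV i). pose proof (Hkb (theta m i)) as Hk.
    set (c1 := Complex.Cmod (Cminus (cis 0) (cis (theta m i)))) in *.
    set (kap := sum_n _ N) in Hk.
    assert (0 <= c1) by apply Cmod_ge_0. pose proof (Cmod_ge_0 kap).
    assert (Hkb0 : 0 <= kb) by nra.
    destruct (Nat.le_gt_cases m (i + p)) as [C1|C1];
      [destruct (Nat.le_gt_cases i (m + p)) as [C2|C2]|].
    (* Near 1 the factor [1 - V i] is zero. *)
    1:{ rewrite Hnear; try lia. replace (_ * _) with 0 by ring. nra. }
    all: (assert (Hf : far i) by (unfold far; lia));
      (assert (Hq : vnorm (q i) <= B * Complex.Cmod kap);
      [ eapply Rle_trans; [apply (Hlow i Hi Hf)|];
        unfold q; rewrite (res_op_plus T HT) (Hr i Hi Hf);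
        unfold Pi; rewrite (res_op_partial_transform T HT ka x s N _ H0 HS);
        replace (INR (S N) * theta m i) with (2 * PI * (INR i - INR m))
          by (rewrite HMp; unfold theta; field; lra);
        rewrite cis_2PI_INR_minus; change (scal (Complex.RtoC 1)) with (@scal C_Ring (CBanach_ModuleSpace X) one);
        rewrite scal_one; unfold minus; rewrite -plus_assoc plus_opp_l plus_zero_r;
        rewrite vnorm_scal_C; apply Rmult_le_compat_l; [lra|];
        fold kap; pose proof (vnorm_ge_0 X x); nra
      | pose proof (vnorm_ge_0 X (q i));
        apply Rle_trans with (c1 * (B * Complex.Cmod kap)); [|nra];
        rewrite Rmult_assoc; apply Rmult_le_compat_l; [easy|]; nra ]). }
  (* Bound for the variation of (1 - z) W r between neighbouring roots: [PI / m + 2 / p] for the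
     change of the coefficient times [B] for the size of [r], then 2 for the coefficient times the
     change of [r]. *)
  set (Gb := ((PI / INR m + 2 * / INR p) * B + 2 * (B * (PI / INR m * (tau * B)))) * vnorm y).
  assert (B3 : vnorm (sum_n (fun i => scal (Cmult (a i) (W i)) (r i)) N) <= INR m * Gb).
  { set (g := fun i => scal (Cmult (Cminus (cis 0) (cis (theta m i))) (W i)) (r i)).
    assert (Hg : forall i, (S i <= N)%nat -> vnorm (minus (g i) (g (S i))) <= Gb).
    { intros i Hi.
      assert (Hinv : 0 < / INR m) by now apply Rinv_0_lt_compat.
      assert (Hinvp : 0 < / INR p) by now apply Rinv_0_lt_compat.
      assert (Hpm : 0 < PI / INR m) by now apply Rdiv_lt_0_compat.
      assert (HGb : 0 <= Gb).
      { unfold Gb. repeat first [lra | apply Rplus_le_le_0_compat | apply Rmult_le_pos]. }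
      destruct (classic (far i /\ far (S i))) as [[Hf Hf']|Hnf].
      (* [far] fails only for |i - m| < p, so when it fails at one of two neighbours the cutoff is
         still 1 at the other. *)
      2:{ assert (Hn : V i = 1 /\ V (S i) = 1).
          { unfold far in Hnf. split; apply Hnear; lia. }
          destruct Hn as [Hn1 Hn2]. unfold g, W. rewrite Hn1 Hn2 Rminus_diag.
          rewrite !Cmult_0_r.
          change (Complex.RtoC 0) with (@zero C_Ring). rewrite !scal_zero_l.
          rewrite minus_zero_r.
          eapply Rle_trans; [|exact HGb]. apply Req_le. exact (vnorm_zero X). }
      assert (Hth : Rabs (theta m i - theta m (S i)) = PI / INR m).
      { rewrite theta_step; [|easy]. rewrite Rabs_left1; lra. }
      set (e := cis (theta m i)). set (e' := cis (theta m (S i))).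
      assert (Hee : Complex.Cmod (Cminus e e') <= PI / INR m).
      { rewrite -Hth. apply Cmod_cis_minus. }
      assert (Hc2 : forall t, Complex.Cmod (Cminus (cis 0) (cis t)) <= 2).
      { intros t. unfold Cminus. eapply Rle_trans; [apply Cmod_triangle|].
        rewrite Cmod_opp !Cmod_cis. lra. }
      (* The resolvent identity: with z and z' the roots at [i] and [S i], applying 1 - zT to
         [r i - r (S i)] leaves (z - z') T r(S i). *)
      assert (Hrd : vnorm (minus (r i) (r (S i))) <= B * (PI / INR m * (tau * B)) * vnorm y).
      { eapply Rle_trans; [apply (Hlow i ltac:(lia) Hf)|].
        rewrite (res_op_minus T HT) (Hr i ltac:(lia) Hf) (res_op_move T (theta m i) (theta m (S i)) (r (S i))) (Hr (S i) Hi Hf').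
        unfold minus. rewrite opp_plus plus_assoc plus_opp_r plus_zero_l vnorm_opp vnorm_scal_C.
        replace (B * (PI / INR m * (tau * B)) * vnorm y)
          with (B * (PI / INR m * (tau * (B * vnorm y)))) by ring.
        apply Rmult_le_compat_l; [lra|].
        apply Rmult_le_compat; try apply Cmod_ge_0; try apply vnorm_ge_0.
        - eapply Rle_trans; [apply Cmod_cis_minus|]. rewrite Rabs_minus_sym Hth. lra.
        - eapply Rle_trans; [apply HTb|]. apply Rmult_le_compat_l; [easy|]. now apply Hrn. }
      replace (minus (g i) (g (S i))) with
        (plus (scal (Cminus (Cmult (Cminus (cis 0) e) (W i)) (Cmult (Cminus (cis 0) e') (W (S i)))) (r i))
              (scal (Cmult (Cminus (cis 0) e') (W (S i))) (minus (r i) (r (S i))))).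
      2:{ change (Cminus (Cmult (Cminus (cis 0) e) (W i)) (Cmult (Cminus (cis 0) e') (W (S i))))
            with (minus (Cmult (Cminus (cis 0) e) (W i) : C_Ring) (Cmult (Cminus (cis 0) e') (W (S i)))).
          rewrite scal_minus_distr_r scal_minus_distr_l. symmetry.
          exact (minus_trans (scal (Cmult (Cminus (cis 0) e') (W (S i))) (r i)) (g i) (g (S i))). }
      eapply Rle_trans; [apply vnorm_plus|]. rewrite !vnorm_scal_C. unfold Gb.
      rewrite Rmult_plus_distr_r. apply Rplus_le_compat.
      - rewrite Rmult_assoc. apply Rmult_le_compat; try apply Cmod_ge_0; try apply vnorm_ge_0; [|now apply Hrn; [lia|]].
        replace (Cminus (Cmult (Cminus (cis 0) e) (W i)) (Cmult (Cminus (cis 0) e') (W (S i))))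
          with (Cplus (Cmult (Copp (Cminus e e')) (W i)) (Cmult (Cminus (cis 0) e') (Cminus (W i) (W (S i))))) by ring.
        eapply Rle_trans; [apply Cmod_triangle|]. rewrite !Cmod_mult Cmod_opp HW.
        apply Rplus_le_compat.
        + specialize (HV i). pose proof (Cmod_ge_0 (Cminus e e')). nra.
        + apply Rmult_le_compat; try apply Cmod_ge_0; [apply Hc2|].
          unfold W. rewrite -RtoC_minus Cmod_R.
          replace (1 - V i - (1 - V (S i))) with (- (V i - V (S i))) by ring.
          rewrite Rabs_Ropp. now apply cutoff_step.
      - rewrite Rmult_assoc. rewrite Cmod_mult HW.
        apply Rmult_le_compat; try apply vnorm_ge_0; [| |exact Hrd].
        + specialize (HV (S i)). pose proof (Cmod_ge_0 (Cminus (cis 0) e')). nra.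
        + specialize (HV (S i)). pose proof (Cmod_ge_0 (Cminus (cis 0) e')).
          pose proof (Hc2 (theta m (S i)) : Complex.Cmod (Cminus (cis 0) e') <= 2). nra. }
    (* z^m changes sign between neighbouring roots, so the [2m] terms group into [m] differences of
       neighbours. *)
    replace N with (2 * (m - 1) + 1)%nat by lia. rewrite sum_n_pairs.
    eapply Rle_trans; [apply vnorm_sum_n|].
    replace (INR m * Gb) with (sum_n (fun _ => Gb) (m - 1))
      by (rewrite sum_n_const; do 2 f_equal; lia).
    apply sum_n_R_le; intros j Hj.
    replace (2 * j + 1)%nat with (S (2 * j)) by lia.
    eapply Rle_trans; [|apply (Hg (2 * j)%nat); lia].
    apply Req_le.
    rewrite -(Rmult_1_l (vnorm (minus _ _))) -(Cmod_cis (INR m * theta m (2 * j))) -vnorm_scal_C.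
    f_equal. unfold a. rewrite !extraction_weight_factor extraction_sign_step; [|easy].
    rewrite scal_minus_distr_l. unfold g, minus. rewrite -scal_opp_l !scal_assoc.
    f_equal; f_equal; Cring. }
  apply Rmult_le_reg_l with (INR (S N)); [lra|].
  replace (INR (S N) * vnorm (minus (s m) (s (m - 1)%nat)))
    with (vnorm (scal (Complex.RtoC (INR (S N))) (minus (s m) (s (m - 1)%nat)))).
  2:{ rewrite vnorm_scal_C Cmod_R Rabs_right; [easy|lra]. }
  rewrite Hsplit. eapply Rle_trans; [apply vnorm_plus|].
  eapply Rle_trans; [apply Rplus_le_compat_l, vnorm_minus|].
  assert (HGy : Gb <= ((PI / INR m + 2 * / INR p) * B + 2 * (B * (PI / INR m * (tau * B)))) * (tau * L)).
  { apply Rmult_le_compat_l; [|easy].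
    assert (0 < PI / INR m) by now apply Rdiv_lt_0_compat.
    assert (0 < / INR p) by now apply Rinv_0_lt_compat.
    repeat first [lra | apply Rplus_le_le_0_compat | apply Rmult_le_pos]. }
  apply (Rmult_le_compat_l (INR m)) in HGy; [|lra].
  rewrite HMp in B1 B2 |- *. lra.
Qed.

(** * Cesaro numbers and the limit *)

Lemma kC_S a n : kC a (S n) = kC a n * (a + INR n) / INR (S n).
Proof. reflexivity. Qed.

Lemma kC_pos a n : 0 < a -> 0 < kC a n.
Proof.
  intros Ha. induction n as [|n IH]; [simpl; lra|]. rewrite kC_S.
  pose proof (pos_INR n). apply Rdiv_lt_0_compat; [nra|apply INR_pos; lia].
Qed.

(** It shows that k^a(n) is smaller than k^(a+1)(n) by a factor of order 1/n. *)
Lemma kC_succ_parameter a n : kC (a + 1) n * a = kC a n * (a + INR n).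
Proof.
  induction n as [|n IH]; [simpl; ring|].
  assert (Hn : INR (S n) <> 0) by (apply not_0_INR; lia).
  rewrite !kC_S.
  replace (kC (a + 1) n * (a + 1 + INR n) / INR (S n) * a)
    with (kC (a + 1) n * a * (a + 1 + INR n) / INR (S n)) by (field; easy).
  rewrite IH {2}S_INR. rewrite S_INR in Hn. rewrite S_INR. field. easy.
Qed.

(** For [a > 0] the sign is that of [a - 1], so the sequence is monotone. *)
Lemma kC_diff a n : kC a (S n) - kC a n = (a - 1) * (kC a n / INR (S n)).
Proof.
  assert (Hn : INR (S n) <> 0) by (apply not_0_INR; lia).
  rewrite kC_S. rewrite S_INR in Hn. rewrite S_INR. field. easy.
Qed.

Lemma kC_S_incr a n : 0 < a -> kC (a + 1) (S n) = kC (a + 1) n * (1 + a / INR (S n)).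
Proof.
  intros Ha. pose proof (kC_diff (a + 1) n).
  replace (a + 1 - 1) with a in H by ring.
  assert (Hn : INR (S n) <> 0) by (apply not_0_INR; lia).
  replace (kC (a + 1) n * (1 + a / INR (S n)))
    with (kC (a + 1) n + a * (kC (a + 1) n / INR (S n))) by (field; easy).
  lra.
Qed.

Lemma kC_le a n j : 0 < a -> kC (a + 1) n <= kC (a + 1) (n + j).
Proof.
  intros Ha. induction j as [|j IH]; [rewrite Nat.add_0_r; lra|].
  rewrite Nat.add_succ_r kC_S_incr; [|easy].
  pose proof (kC_pos (a + 1) (n + j) ltac:(lra)).
  assert (0 < a / INR (S (n + j))) by (apply Rdiv_lt_0_compat; [lra|apply INR_pos; lia]).
  nra.
Qed.

Lemma kC_mono a n n' : 0 < a -> (n <= n')%nat -> kC (a + 1) n <= kC (a + 1) n'.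
Proof.
  intros Ha H. replace n' with (n + (n' - n))%nat by lia. now apply kC_le.
Qed.

(** Each of at most [m] steps multiplies by no more than [1 + a/m <= exp (a/m)]. *)
Lemma kC_doubling_upper a m N :
  0 < a -> (0 < m)%nat -> S N = (2 * m)%nat -> kC (a + 1) N <= exp a * kC (a + 1) m.
Proof.
  intros Ha Hm HN. pose proof (INR_pos m Hm) as Hmp.
  assert (H : forall j, kC (a + 1) (m + j) <= exp (a / INR m * INR j) * kC (a + 1) m).
  { induction j as [|j IH].
    - rewrite Nat.add_0_r. simpl INR. rewrite Rmult_0_r exp_0. lra.
    - rewrite Nat.add_succ_r kC_S_incr; [|easy].
      rewrite (S_INR j) (Rmult_plus_distr_l (a / INR m)) Rmult_1_r exp_plus.
      assert (Hq : 1 + a / INR (S (m + j)) <= exp (a / INR m)).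
      { eapply Rle_trans; [|apply exp_ineq1_le]. apply Rplus_le_compat_l.
        apply Rmult_le_compat_l; [lra|]. apply Rinv_le_contravar; [easy|]. apply le_INR; lia. }
      assert (0 <= 1 + a / INR (S (m + j))).
      { assert (0 < a / INR (S (m + j))) by (apply Rdiv_lt_0_compat; [lra|apply INR_pos; lia]). lra. }
      pose proof (kC_pos (a + 1) (m + j) ltac:(lra)).
      replace (exp (a / INR m * INR j) * exp (a / INR m) * kC (a + 1) m)
        with (exp (a / INR m * INR j) * kC (a + 1) m * exp (a / INR m)) by ring.
      apply Rmult_le_compat; lra. }
  specialize (H m). replace (a / INR m * INR m) with a in H by (field; lra).
  eapply Rle_trans; [|exact H]. apply kC_mono; [easy|lia].
Qed.

(** Each of the [n] steps adds at least [a/(2n)] times the value at [n]. *)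
Lemma kC_doubling_lower a n :
  0 < a -> (0 < n)%nat -> kC (a + 1) n * (1 + a / 2) <= kC (a + 1) (2 * n).
Proof.
  intros Ha Hn. pose proof (INR_pos n Hn) as Hnp.
  assert (H : forall j, (j <= n)%nat ->
     kC (a + 1) n * (1 + a / (2 * INR n) * INR j) <= kC (a + 1) (n + j)).
  { induction j as [|j IH]; intros Hj.
    - rewrite Nat.add_0_r. simpl INR. lra.
    - rewrite Nat.add_succ_r kC_S_incr; [|easy]. specialize (IH ltac:(lia)).
      rewrite (S_INR j).
      pose proof (kC_pos (a + 1) n ltac:(lra)). pose proof (kC_le a n j Ha).
      assert (a / (2 * INR n) <= a / INR (S (n + j))).
      { apply Rmult_le_compat_l; [lra|]. apply Rinv_le_contravar; [apply INR_pos; lia|].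
        replace (2 * INR n) with (INR (2 * n)) by (rewrite mult_INR; reflexivity).
        apply le_INR; lia. }
      assert (0 < a / (2 * INR n)) by (apply Rdiv_lt_0_compat; lra).
      nra. }
  specialize (H n (le_n _)).
  replace (a / (2 * INR n) * INR n) with (a / 2) in H by (field; lra).
  now replace (2 * n)%nat with (n + n)%nat by lia.
Qed.

(** The doubling estimate gives geometric growth along the powers of 2, and monotonicity covers the
    other indices. *)
Lemma kC_unbounded a A :
  0 < a -> exists N, forall n, (N <= n)%nat -> A <= kC (a + 1) n.
Proof.
  intros Ha.
  assert (H : forall i, (1 + a / 2) ^ i <= kC (a + 1) (2 ^ i)).
  { induction i as [|i IH].
    - apply Rle_trans with (kC (a + 1) 0); [simpl; lra|apply kC_mono; [easy|simpl; lia]].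
    - assert (0 < 2 ^ i)%nat by (pose proof (Nat.pow_nonzero 2 i); lia).
      pose proof (kC_doubling_lower a (2 ^ i) Ha H). simpl (2 ^ S i)%nat.
      change (2 ^ i + (2 ^ i + 0))%nat with (2 * 2 ^ i)%nat. simpl pow. nra. }
  destruct (INR_unbounded (A / (a / 2))) as [i Hi].
  exists (2 ^ i)%nat. intros n Hn.
  apply Rle_trans with (kC (a + 1) (2 ^ i)); [|now apply kC_mono].
  eapply Rle_trans; [|apply H]. eapply Rle_trans; [|apply poly; lra].
  assert (HA : A = A / (a / 2) * (a / 2)) by (field; lra).
  rewrite HA. nra.
Qed.

(** Partial summation. With [sg] equal to 1 or -1 the hypothesis expresses monotonicity, and the
    total variation telescopes to [sg (c N - c 0)]. *)
Lemma Abel_bound (c : nat -> R) (sg : R) N t :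
  (forall n, Rabs (c (S n) - c n) <= sg * (c (S n) - c n)) ->
  Complex.Cmod (Cminus (cis 0) (cis t)) *
    Complex.Cmod (sum_n (fun n => Cmult (Complex.RtoC (c n)) (cis (INR n * t))) N)
  <= Rabs (c 0%nat) + sg * (c N - c 0%nat) + Rabs (c N).
Proof.
  intros Hc.
  set (S_ := fun N => sum_n (fun n => Cmult (Complex.RtoC (c n)) (cis (INR n * t))) N).
  assert (H : forall n, Complex.Cmod (Cplus (Cmult (Cminus (cis 0) (cis t)) (S_ n))
     (Cmult (Complex.RtoC (c n)) (cis (INR (S n) * t)))) <= Rabs (c 0%nat) + sg * (c n - c 0%nat)).
  { induction n as [|n IH].
    - unfold S_. rewrite sum_O. simpl INR. rewrite Rmult_0_l Rmult_1_l cis_0.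
      replace (Cplus _ _) with (Complex.RtoC (c 0%nat)) by ring. rewrite Cmod_R. lra.
    - unfold S_. rewrite sum_Sn. fold (S_ n).
      replace (Cplus _ _) with (Cplus (Cplus (Cmult (Cminus (cis 0) (cis t)) (S_ n))
         (Cmult (Complex.RtoC (c n)) (cis (INR (S n) * t))))
         (Cmult (Complex.RtoC (c (S n) - c n)) (cis (INR (S n) * t)))).
      + eapply Rle_trans; [apply Cmod_triangle|].
        rewrite (Cmod_mult (Complex.RtoC _)) Cmod_cis Cmod_R. specialize (Hc n). lra.
      + rewrite (S_INR (S n)) Rmult_plus_distr_r Rmult_1_l cis_plus cis_0 RtoC_minus.
        Cring. }
  specialize (H N). rewrite -Cmod_mult.
  fold (S_ N).
  replace (Cmult (Cminus (cis 0) (cis t)) (S_ N)) with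
    (Cplus (Cplus (Cmult (Cminus (cis 0) (cis t)) (S_ N)) (Cmult (Complex.RtoC (c N)) (cis (INR (S N) * t))))
       (Copp (Cmult (Complex.RtoC (c N)) (cis (INR (S N) * t))))) by ring.
  eapply Rle_trans; [apply Cmod_triangle|].
  rewrite Cmod_opp (Cmod_mult (Complex.RtoC _)) Cmod_cis Cmod_R. lra.
Qed.

(** As [kC a 0 = 1], partial summation gives [2 kC a N] in the increasing case [a >= 1] and 2 in the
    decreasing one; the sum covers both. *)
Lemma kC_transform_bound a N t :
  0 < a ->
  Complex.Cmod (Cminus (cis 0) (cis t)) *
    Complex.Cmod (sum_n (fun n => Cmult (Complex.RtoC (kC a n)) (cis (INR n * t))) N)
  <= 2 + 2 * kC a N.
Proof.
  intros Ha. pose proof (kC_pos a N Ha) as HN.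
  assert (Hd : forall n, 0 < kC a n / INR (S n)).
  { intros n. apply Rdiv_lt_0_compat; [now apply kC_pos|apply INR_pos; lia]. }
  destruct (Rle_lt_dec 1 a) as [H1|H1].
  - eapply Rle_trans; [apply (Abel_bound (kC a) 1)|].
    + intros n. rewrite kC_diff. specialize (Hd n). rewrite Rabs_right; nra.
    + simpl (kC a 0). rewrite !Rabs_right; lra.
  - eapply Rle_trans; [apply (Abel_bound (kC a) (-1))|].
    + intros n. rewrite kC_diff. specialize (Hd n). rewrite Rabs_left1; nra.
    + simpl (kC a 0). rewrite !Rabs_right; lra.
Qed.

(** * Operator norms and the recurrence of the Cesaro sums *)

(** [opnorm] is chosen by [epsilon] and is known to be the supremum only once one exists, which the
    bound [c] guarantees. *)
Lemma opnorm_is_lub (X : CBanach) (A : X -> X) c :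
  (forall x, vnorm x <= 1 -> vnorm (A x) <= c) ->
  is_lub (unit_ball_image A) (opnorm A).
Proof.
  intros H. unfold opnorm. apply epsilon_spec.
  destruct (completeness (unit_ball_image A)) as [l Hl].
  - exists c. intros r [x [Hx ->]]. auto.
  - exists (vnorm (A zero)), zero. split; [|easy].
    apply Rle_trans with 0; [|lra]. apply Req_le. exact (vnorm_zero X).
  - now exists l.
Qed.

Lemma opnorm_bounds (X : CBanach) (A : X -> X) c :
  (forall x, vnorm x <= 1 -> vnorm (A x) <= c) -> 0 <= opnorm A <= c.
Proof.
  intros H. destruct (opnorm_is_lub X A c H) as [Hub Hleast]. split.
  - eapply Rle_trans; [apply (vnorm_ge_0 X (A zero))|]. apply Hub. exists zero.
    split; [|easy]. apply Rle_trans with 0; [|lra]. apply Req_le. exact (vnorm_zero X).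
  - apply Hleast. intros r [x [Hx ->]]. auto.
Qed.

Lemma DeltaT_sum_n (X : CBanach) a (T : X -> X) n x :
  DeltaT a T n x = sum_n (fun j => scal (Complex.RtoC (kC a (n - j))) (Nat.iter j T x)) n.
Proof. unfold DeltaT. rewrite vsum_sum_n. reflexivity. Qed.

Lemma DeltaT_0 (X : CBanach) a (T : X -> X) x :
  DeltaT a T 0 x = scal (Complex.RtoC (kC a 0)) x.
Proof. rewrite DeltaT_sum_n sum_O. reflexivity. Qed.

Lemma bounded_linear_sum_n (X : CBanach) (T : X -> X) (f : nat -> X) n :
  bounded_linear T -> T (sum_n f n) = sum_n (fun j => T (f j)) n.
Proof.
  intros HT. induction n as [|n IH].
  - now rewrite !sum_O.
  - now rewrite !sum_Sn (bounded_linear_plus T HT) IH.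
Qed.

(** The term [j = 0] gives the multiple of [x]; all others carry a factor [T]. *)
Lemma DeltaT_S (X : CBanach) a (T : X -> X) n x :
  bounded_linear T ->
  DeltaT a T (S n) x = plus (T (DeltaT a T n x)) (scal (Complex.RtoC (kC a (S n))) x).
Proof.
  intros HT. rewrite !DeltaT_sum_n (bounded_linear_sum_n X T _ n HT) plus_comm.
  unfold sum_n. rewrite sum_Sn_m; [|lia]. f_equal.
  rewrite -sum_n_m_S. apply sum_n_m_ext; intros j.
  now rewrite (bounded_linear_scal T HT).
Qed.

(** The bound depends on [n]; it serves to make [opnorm (MT a T n)] a true supremum, so that
    [Cesaro_bounded] yields estimates at vectors. *)
Lemma DeltaT_crude_bound (X : CBanach) a (T : X -> X) n :
  bounded_linear T ->
  exists c, forall x, vnorm x <= 1 -> vnorm (DeltaT a T n x) <= c.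
Proof.
  intros HT. destruct (bounded_linear_bound T HT) as [tau [Htau HTb]].
  induction n as [|n [c IH]].
  - exists (Rabs (kC a 0)). intros x Hx. rewrite DeltaT_0 vnorm_scal_C Cmod_R.
    pose proof (Rabs_pos (kC a 0)). pose proof (vnorm_ge_0 X x). nra.
  - exists (tau * c + Rabs (kC a (S n))). intros x Hx. rewrite (DeltaT_S X a T n x HT).
    eapply Rle_trans; [apply vnorm_plus|]. apply Rplus_le_compat.
    + eapply Rle_trans; [apply HTb|]. apply Rmult_le_compat_l; auto.
    + rewrite vnorm_scal_C Cmod_R.
      pose proof (Rabs_pos (kC a (S n))). pose proof (vnorm_ge_0 X x). nra.
Qed.

Lemma Cesaro_bounded_DeltaT (X : CBanach) a (T : X -> X) :
  0 < a -> bounded_linear T -> Cesaro_bounded a T ->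
  exists K, 0 <= K /\
    forall n x, vnorm x <= 1 -> vnorm (DeltaT a T n x) <= K * kC (a + 1) n.
Proof.
  intros Ha HT [K HK].
  assert (HMT : forall n x, vnorm (MT a T n x) = / kC (a + 1) n * vnorm (DeltaT a T n x)).
  { intros n x. pose proof (kC_pos (a + 1) n ltac:(lra)) as Hk.
    transitivity (vnorm (scal (Complex.RtoC (/ kC (a + 1) n)) (DeltaT a T n x))); [reflexivity|].
    rewrite vnorm_scal_C Cmod_R Rabs_right; [easy|].
    apply Rle_ge, Rlt_le, Rinv_0_lt_compat; lra. }
  assert (H : forall n x, vnorm x <= 1 -> vnorm (MT a T n x) <= K).
  { intros n x Hx. destruct (DeltaT_crude_bound X a T n HT) as [c Hc].
    eapply Rle_trans; [|apply (HK n)].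
    apply (opnorm_is_lub X (MT a T n) (/ kC (a + 1) n * c)).
    - intros z Hz. rewrite HMT. apply Rmult_le_compat_l; [|auto].
      apply Rlt_le, Rinv_0_lt_compat, kC_pos; lra.
    - now exists x. }
  exists K. split.
  - eapply Rle_trans; [apply (vnorm_ge_0 X (MT a T 0 zero))|]. apply H.
    apply Rle_trans with 0; [|lra]. apply Req_le. exact (vnorm_zero X).
  - intros n x Hx. pose proof (kC_pos (a + 1) n ltac:(lra)) as Hk.
    specialize (H n x Hx). rewrite HMT in H.
    apply Rmult_le_reg_l with (/ kC (a + 1) n); [now apply Rinv_0_lt_compat|].
    replace (/ kC (a + 1) n * (K * kC (a + 1) n)) with K by (field; lra). easy.
Qed.

(** * Uniform estimates and the choice of parameters *)

(** The arc away from 1 is a union of two compact intervals of angles, on each of which the lower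
    bound is uniform. *)
Lemma res_op_uniform (X : CBanach) (T : X -> X) del :
  bounded_linear T ->
  (forall l : Cpx, Defs.Cmod l = 1 -> in_spectrum T l -> l = Cx1) ->
  0 < del ->
  exists B, 0 < B /\ forall t, del <= Rabs t <= PI ->
     (forall z, vnorm z <= B * vnorm (res_op T t z)) /\
     (forall y, exists z, res_op T t z = y).
Proof.
  intros HT Hs Hdel. pose proof PI_RGT_0.
  assert (HE : forall t, del <= Rabs t <= PI -> cis t <> Complex.RtoC 1).
  { intros t Ht. apply cis_neq_1; [|lra]. intros ->. rewrite Rabs_R0 in Ht. lra. }
  destruct (res_op_lower_bound_compact T HT del PI) as [B1 [HB1 H1]].
  { intros t Ht. apply res_op_invertible; auto. apply HE. rewrite Rabs_right; lra. }
  destruct (res_op_lower_bound_compact T HT (- PI) (- del)) as [B2 [HB2 H2]].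
  { intros t Ht. apply res_op_invertible; auto. apply HE. rewrite Rabs_left1; lra. }
  exists (Rmax B1 B2). split; [pose proof (Rmax_l B1 B2); lra|].
  intros t Ht. split; [|apply res_op_invertible; auto].
  intros z. destruct (Rle_lt_dec 0 t) as [H0|H0].
  - rewrite Rabs_right in Ht; [|lra].
    eapply Rle_trans; [apply (H1 t); easy|].
    apply Rmult_le_compat_r; [apply vnorm_ge_0|apply Rmax_l].
  - rewrite Rabs_left in Ht; [|lra].
    eapply Rle_trans; [apply (H2 t); split; lra|].
    apply Rmult_le_compat_r; [apply vnorm_ge_0|apply Rmax_r].
Qed.

(** With s, k at [n] and s', k' at [n + 1], the difference is (s' - s)/k' + (1/k' - 1/k) s, and 1/k
    - 1/k' = (a/(n+1))/k'. *)
Lemma MT_difference_le (X : CBanach) a (T : X -> X) n x K e :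
  0 < a -> vnorm (DeltaT a T n x) <= K * kC (a + 1) n ->
  vnorm (minus (DeltaT a T (S n) x) (DeltaT a T n x)) <= e * kC (a + 1) (S n) ->
  vnorm (vsub (MT a T (S n) x) (MT a T n x)) <= e + K * a / INR (S n).
Proof.
  intros Ha HK He.
  pose proof (kC_pos (a + 1) n ltac:(lra)) as Hk.
  pose proof (kC_pos (a + 1) (S n) ltac:(lra)) as Hk'.
  assert (Hn : 0 < INR (S n)) by (apply INR_pos; lia).
  set (k := kC (a + 1) n) in *. set (k' := kC (a + 1) (S n)) in *.
  set (s := DeltaT a T n x) in *. set (s' := DeltaT a T (S n) x) in *.
  change (vsub (MT a T (S n) x) (MT a T n x)) with
    (minus (scal (Complex.RtoC (/ k')) s') (scal (Complex.RtoC (/ k)) s)).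
  rewrite (minus_trans (scal (Complex.RtoC (/ k')) s)).
  rewrite -scal_minus_distr_l -scal_minus_distr_r.
  change (@minus C_Ring (Complex.RtoC (/ k')) (Complex.RtoC (/ k)))
    with (Cminus (Complex.RtoC (/ k')) (Complex.RtoC (/ k))).
  rewrite -RtoC_minus. eapply Rle_trans; [apply vnorm_plus|].
  rewrite !vnorm_scal_C !Cmod_R. apply Rplus_le_compat.
  - rewrite Rabs_right; [|apply Rle_ge, Rlt_le, Rinv_0_lt_compat; lra].
    apply Rmult_le_reg_l with k'; [easy|]. rewrite -Rmult_assoc Rinv_r; [|lra].
    rewrite Rmult_1_l (Rmult_comm k'). exact He.
  - assert (Hkk : k' = k * (1 + a / INR (S n))) by now apply kC_S_incr.
    assert (Han : 0 < a / INR (S n)) by now apply Rdiv_lt_0_compat.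
    assert (Hd : / k - / k' = a / INR (S n) * / k').
    { rewrite Hkk. field. repeat split; lra. }
    rewrite Rabs_minus_sym Hd.
    assert (Hik' : 0 < / k') by now apply Rinv_0_lt_compat.
    rewrite Rabs_right; [|nra].
    assert (HK0 : 0 <= K).
    { pose proof (vnorm_ge_0 X s). destruct (Rle_lt_dec 0 K); [easy|]. nra. }
    apply Rle_trans with (a / INR (S n) * / k' * (K * k')).
    + apply Rmult_le_compat_l; [nra|]. assert (k <= k') by nra. nra.
    + apply Req_le. field. lra.
Qed.

Lemma archimed_div A e : 0 < e -> exists N, forall n, (N <= n)%nat -> (0 < n)%nat -> A / INR n <= e.
Proof.
  intros He. destruct (INR_unbounded (A / e)) as [N HN]. exists N. intros n Hn Hn0.
  pose proof (INR_pos n Hn0). apply le_INR in Hn.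
  apply Rmult_le_reg_r with (INR n); [easy|].
  replace (A / INR n * INR n) with A by (field; lra).
  replace A with (A / e * e) by (field; lra). nra.
Qed.

(** The quotient [m / Q] keeps p/m between 1/(2Q) and 1/Q, so the angular width of the cutoff stays
    comparable to 1/Q as [m] grows. *)
Lemma cutoff_width_exists Q m :
  (0 < Q)%nat -> (2 * Q <= m)%nat ->
  exists p, (0 < p)%nat /\ (Q * p <= m)%nat /\ (m <= 2 * Q * p)%nat.
Proof.
  intros HQ Hm. exists (m / Q)%nat.
  pose proof (Nat.div_mod_eq m Q) as H. pose proof (Nat.mod_upper_bound m Q ltac:(lia)).
  assert (1 <= m / Q)%nat by (apply Nat.div_le_lower_bound; lia).
  split; [lia|]. split; nia.
Qed.

(** The order of choices matters: [Q] fixes the width of the cutoff from [e], then [B] bounds the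
    resolvent outside it, and only then is [n] taken large. Each of the three parts receives
    [e / 3]. *)
Lemma DeltaT_difference_small (X : CBanach) a (T : X -> X) e :
  0 < a -> bounded_linear T -> Cesaro_bounded a T ->
  (forall l : Cpx, Defs.Cmod l = 1 -> in_spectrum T l -> l = Cx1) ->
  0 < e ->
  exists n0, forall n x, (n0 <= n)%nat -> vnorm x <= 1 ->
    vnorm (minus (DeltaT a T (S n) x) (DeltaT a T n x)) <= e * kC (a + 1) (S n).
Proof.
  intros Ha HT HC Hs He. pose proof PI_RGT_0 as HP.
  destruct (Cesaro_bounded_DeltaT X a T Ha HT HC) as [K [HK0 HK]].
  destruct (bounded_linear_bound T HT) as [tau [Htau HTb]].
  set (A := exp a). assert (HA : 0 < A) by apply exp_pos.
  (* The cutoff part of [difference_bound] is 6 (2 pi p/m) K A km, with p/m at most 1/Q. *)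
  destruct (archimed_div (12 * PI * K * A) (e / 3) ltac:(lra)) as [Q0 HQ0].
  (* At least 3, so that [Q p <= m] implies [3 p <= m]. *)
  set (Q := (Q0 + 3)%nat).
  assert (HQ : 12 * PI * K * A / INR Q <= e / 3) by (apply HQ0; lia).
  assert (HQp : 0 < INR Q) by (apply INR_pos; lia).
  (* A lower bound for pi p/m, independent of [m], because [m <= 2 Q p]. *)
  destruct (res_op_uniform X T (PI / (2 * INR Q)) HT Hs) as [B [HB Hres]].
  { apply Rdiv_lt_0_compat; lra. }
  (* Makes the constant [2 B] at most [(e / 3) km]. *)
  destruct (kC_unbounded a (2 * B / (e / 3)) Ha) as [n1 Hn1].
  (* Collects the terms of order km/m: the growing part of the bound for kappa, and the oscillating
     part with 1/p replaced by 2Q/m. *)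
  set (C2 := 2 * B * A * a + / 2 * ((PI + 4 * INR Q) * B + 2 * (B * (PI * (tau * B)))) * (tau * (K * A))).
  destruct (archimed_div C2 (e / 3) ltac:(lra)) as [n2 Hn2].
  exists (n1 + n2 + 2 * Q)%nat. intros n x Hn Hx.
  set (m := S n). set (N := (2 * m - 1)%nat).
  assert (HN : S N = (2 * m)%nat) by lia.
  assert (Hm : (0 < m)%nat) by lia.
  pose proof (INR_pos m Hm) as Hmp.
  destruct (cutoff_width_exists Q m ltac:(lia) ltac:(lia)) as [p [Hp [Hpu Hpl]]].
  pose proof (INR_pos p Hp) as Hpp.
  apply le_INR in Hpl as Hpl'. rewrite !mult_INR in Hpl'. simpl (INR 2) in Hpl'.
  apply le_INR in Hpu as Hpu'. rewrite mult_INR in Hpu'.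
  set (km := kC (a + 1) m). assert (Hkm : 0 < km) by (apply kC_pos; lra).
  assert (HkN : kC (a + 1) N <= A * km) by (now apply kC_doubling_upper).
  pose proof (difference_bound X T (kC a) x (fun n => DeltaT a T n x) m p N B tau
    (K * (A * km)) (2 + 2 * kC a N) HT (DeltaT_0 X a T x)
    (fun n => DeltaT_S X a T n x HT) Hp ltac:(nia) HN HB Htau HTb) as Hmain.
  assert (Hbound := Hmain
    ltac:(intros t Ht; apply Hres; split; [|lra]; eapply Rle_trans; [|apply Ht];
      apply Rmult_le_reg_r with (2 * INR Q * INR m); [nra|];
      replace (PI / (2 * INR Q) * (2 * INR Q * INR m)) with (PI * INR m) by (field; lra);
      replace (PI * INR p / INR m * (2 * INR Q * INR m)) with (PI * (2 * INR Q * INR p)) by (field; lra);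
      nra)
    ltac:(intros j Hj; eapply Rle_trans; [apply HK; easy|]; apply Rmult_le_compat_l; [easy|];
      eapply Rle_trans; [|exact HkN]; now apply kC_mono)
    Hx
    ltac:(intros t; now apply kC_transform_bound)).
  clear Hmain. replace (m - 1)%nat with n in Hbound by lia.
  eapply Rle_trans; [exact Hbound|]. clear Hbound.
  assert (Him : 0 < / INR m) by now apply Rinv_0_lt_compat.
  (* From k^a(N) (a + N) = a k^(a+1)(N), with [N >= m] and doubling. *)
  assert (Hkap : kC a N <= A * km * a * / INR m).
  { apply Rmult_le_reg_r with (INR m); [easy|].
    replace (A * km * a * / INR m * INR m) with (A * km * a) by (field; lra).
    assert (kC (a + 1) N * a = kC a N * (a + INR N)) by apply kC_succ_parameter.
    pose proof (kC_pos a N Ha). assert (INR m <= INR N) by (apply le_INR; lia). nra. }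
  assert (H1 : 6 * (2 * PI * INR p / INR m) * (K * (A * km)) <= e / 3 * km).
  { apply Rle_trans with (12 * PI * K * A / INR Q * km); [|nra].
    assert (Hpm : INR p / INR m <= / INR Q).
    { apply Rmult_le_reg_r with (INR Q * INR m); [nra|].
      replace (INR p / INR m * (INR Q * INR m)) with (INR Q * INR p) by (field; lra).
      replace (/ INR Q * (INR Q * INR m)) with (INR m) by (field; lra). easy. }
    replace (6 * (2 * PI * INR p / INR m) * (K * (A * km)))
      with (12 * PI * K * A * km * (INR p / INR m)) by (field; lra).
    replace (12 * PI * K * A / INR Q * km) with (12 * PI * K * A * km * / INR Q) by (field; lra).
    apply Rmult_le_compat_l; [|easy].
    repeat first [lra | apply Rmult_le_pos]. }
  assert (H2 : B * (2 + 2 * kC a N) <= e / 3 * km + 2 * B * A * a * / INR m * km).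
  { assert (Hk : 2 * B / (e / 3) <= km) by (apply Hn1; lia).
    assert (2 * B <= e / 3 * km).
    { replace (2 * B) with (e / 3 * (2 * B / (e / 3))) by (field; lra). nra. }
    assert (B * kC a N <= B * (A * km * a * / INR m)) by (apply Rmult_le_compat_l; lra).
    lra. }
  assert (Hip : / INR p <= 2 * INR Q * / INR m).
  { apply Rmult_le_reg_r with (INR p * INR m); [nra|].
    replace (/ INR p * (INR p * INR m)) with (INR m) by (field; lra).
    replace (2 * INR Q * / INR m * (INR p * INR m)) with (2 * INR Q * INR p) by (field; lra). lra. }
  assert (H3 : / 2 * ((PI / INR m + 2 * / INR p) * B + 2 * (B * (PI / INR m * (tau * B)))) * (tau * (K * (A * km)))
    <= / 2 * ((PI + 4 * INR Q) * B + 2 * (B * (PI * (tau * B)))) * (tau * (K * A)) * / INR m * km).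
  { replace (/ 2 * ((PI + 4 * INR Q) * B + 2 * (B * (PI * (tau * B)))) * (tau * (K * A)) * / INR m * km)
      with (/ 2 * ((PI / INR m + 2 * (2 * INR Q * / INR m)) * B + 2 * (B * (PI / INR m * (tau * B)))) * (tau * (K * (A * km))))
      by (field; lra).
    apply Rmult_le_compat_r; [repeat first [lra | apply Rmult_le_pos]|].
    apply Rmult_le_compat_l; [lra|]. apply Rplus_le_compat_r.
    apply Rmult_le_compat_r; lra. }
  assert (H4 : C2 * / INR m * km <= e / 3 * km).
  { apply Rmult_le_compat_r; [lra|]. apply Hn2; lia. }
  unfold C2 in H4. lra.
Qed.

Theorem theorem4p1 (X : CBanach) (alpha : R) (T : X -> X) :
  0 < alpha ->
  bounded_linear T ->
  Cesaro_bounded alpha T ->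
  (forall l : Cpx, Cmod l = 1 -> in_spectrum T l -> l = Cx1) ->
  Un_cv (fun n => opnorm (fun x => vsub (MT alpha T (S n) x) (MT alpha T n x))) 0.
Proof.
  intros Ha HT HC Hs eps Heps.
  destruct (Cesaro_bounded_DeltaT X alpha T Ha HT HC) as [K [HK0 HK]].
  destruct (DeltaT_difference_small X alpha T (eps / 3) Ha HT HC Hs ltac:(lra)) as [n1 Hn1].
  destruct (archimed_div (K * alpha) (eps / 3) ltac:(lra)) as [n2 Hn2].
  exists (n1 + n2)%nat. intros n Hn.
  (* Two thirds of [eps] leave room for the strict inequality of the limit. *)
  destruct (opnorm_bounds X (fun x => vsub (MT alpha T (S n) x) (MT alpha T n x)) (eps / 3 + eps / 3))
    as [Hlo Hhi].
  { intros x Hx. eapply Rle_trans.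
    - apply (MT_difference_le X alpha T n x K (eps / 3) Ha); [now apply HK|apply Hn1; [lia|easy]].
    - apply Rplus_le_compat_l, Hn2; lia. }
  unfold R_dist, Rdist. rewrite Rminus_0_r Rabs_right; lra.
Qed.
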